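(* Let $(A,q)$ be a finite metric abelian group, let $n\ge2$ and $Q,P\in\mathcal Q(q)$. Let $R$ be any one of the three operators $$R^{\mathrm I}_Q=|A|^{-1/2}\sum_{a\in A}Q(a)X_a\otimes Z_a,\qquad R^{\mathrm{II}}_{Q,P}=\overline{\gamma(P)}|A|^{-1}\sum_{t,c\in A}Q(t)P(c)(X_tZ_c)\otimes(X_{-t}Z_c)$$ on $V\otimes V$, or $$R^{\mathrm{III}}=|A|^{-1}\sum_{a,b\in A}q(a)^{-1}q(b)^{-1}\mathsf P_a\mathsf Q_{-b}$$ on $W\otimes W$. Then the image $\rho_{R,n}(\mathcal B_n)$ of the associated unitary braid group representation is a finite group.
   Context: $\mathrm U(1)$ denotes the complex numbers of modulus one. A finite metric abelian group $(A,q)$ is a finite abelian group $A$ (written additively) with $q:A\to\mathrm U(1)$ such that $q(-a)=q(a)$ and $\langle a,b\rangle:=\frac{q(a+b)}{q(a)q(b)}$ is a nondegenerate symmetric bicharacter on $A$. $\mathcal Q(q)=\{q\chi:\chi\in\mathrm{Hom}(A,\mathrm U(1))\}$ and $\gamma(F)=|A|^{-1/2}\sum_{a\in A}F(a)$. $V=\mathbb C[A]$ is the Hilbert space with orthonormal basis $\{e_x:x\in A\}$, $W=V\otimes V$, $X_ae_x=e_{x+a}$, $Z_ae_x=\langle a,x\rangle e_x$. On $W\otimes W=(V\otimes V)\otimes(V\otimes V)$, $\mathsf P_a=(I\otimes Z_a)\otimes(Z_a\otimes I)$ and $\mathsf Q_b=(X_b\otimes I)\otimes(X_b\otimes X_b)$.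 These operators are unitary Yang--Baxter operators. $\mathcal B_n$ is the braid group on $n$ strands with Artin generators $\sigma_i$; for a unitary Yang--Baxter operator $R$ on $D$, $\rho_{R,n}:\mathcal B_n\to\mathrm U(D^{\otimes n})$ is $\rho_{R,n}(\sigma_i)=I^{\otimes(i-1)}\otimes R\otimes I^{\otimes(n-i-1)}$. *)

(* Defs.v *)
From HB Require Import structures.
From mathcomp Require Import all_boot all_order all_algebra.
From mathcomp Require Import boolp classical_sets cardinality reals.
From mathcomp.real_closed Require Import complex mxtens.

Set Implicit Arguments.
Unset Strict Implicit.
Unset Printing Implicit Defensive.

Local Open Scope quotient_scope.
Import Order.TTheory GRing.Theory Num.Theory.
Local Open Scope ring_scope.

Section BraidGroup.
Variable n : nat.

(* The generators are numbered from 0; a letter (i, true) stands for sigma_i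
   and (i, false) for its inverse. *)
Definition braid_word := seq ('I_n.-1 * bool).

Inductive braid_relator : braid_word -> braid_word -> Prop :=
| relator_cancel (i : 'I_n.-1) b : braid_relator [:: (i, b); (i, ~~ b)] [::]
| relator_far (i j : 'I_n.-1) : (i.+1 < j)%N ->
    braid_relator [:: (i, true); (j, true)] [:: (j, true); (i, true)]
| relator_adjacent (i j : 'I_n.-1) : i.+1 = j :> nat ->
    braid_relator [:: (i, true); (j, true); (i, true)]
                  [:: (j, true); (i, true); (j, true)].

Inductive braid_equiv : braid_word -> braid_word -> Prop :=
| braid_step u r s v : braid_relator r s ->
    braid_equiv (u ++ r ++ v) (u ++ s ++ v)
| braid_refl u : braid_equiv u u
| braid_sym u v : braid_equiv u v -> braid_equiv v u
| braid_trans v u w : braid_equiv u v -> braid_equiv v w -> braid_equiv u w.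

Definition braid_equivb (u v : braid_word) : bool := `[< braid_equiv u v >].

Lemma braid_equivb_equiv : equiv_class_of braid_equivb.
Proof.
split=> [u|u v|v u w]; first by apply/asboolP; apply: braid_refl.
  by apply/asboolP/asboolP => /braid_sym.
by move=> /asboolP uv /asboolP vw; apply/asboolP; apply: braid_trans vw.
Qed.

Canonical braid_equiv_rel := EquivRelPack braid_equivb_equiv.

Definition braid : Type := {eq_quot braid_equivb}.

HB.instance Definition _ := Choice.on braid.
HB.instance Definition _ := EqQuotient.on braid.

Definition inv_word (u : braid_word) : braid_word :=
  rev [seq (x.1, ~~ x.2) | x <- u].

Lemma braid_cat u u' v v' : braid_equiv u u' -> braid_equiv v v' ->
  braid_equiv (u ++ v) (u' ++ v').
Proof.
move=> uu' vv'; apply: (@braid_trans (u' ++ v)).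
  elim: uu' => [a r s b rs|a|a b _|b a c _ ab _ bc].
  - by rewrite -!catA; apply: braid_step.
  - exact: braid_refl.
  - exact: braid_sym.
  - exact: braid_trans bc.
elim: vv' => [a r s b rs|a|a b _|b a c _ ab _ bc].
- by rewrite !(catA u'); apply: braid_step.
- exact: braid_refl.
- exact: braid_sym.
- exact: braid_trans bc.
Qed.

Lemma inv_wordK : involutive inv_word.
Proof.
move=> u; rewrite /inv_word map_rev revK -map_comp -[RHS]map_id.
by apply: eq_map => -[i b] /=; rewrite negbK.
Qed.

Lemma braid_catV u : braid_equiv (u ++ inv_word u) [::].
Proof.
elim: u => [|[i b] u IHu]; first exact: braid_refl.
have -> : inv_word ((i, b) :: u) = inv_word u ++ [:: (i, ~~ b)].
  by rewrite /inv_word /= rev_cons cats1.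
rewrite -cat1s -!catA (catA u).
apply: (@braid_trans ([:: (i, b)] ++ [::] ++ [:: (i, ~~ b)])).
  apply: braid_cat; first exact: braid_refl.
  by apply: braid_cat; [exact: IHu|exact: braid_refl].
exact: (@braid_step [::] _ _ [::] (relator_cancel i b)).
Qed.

Lemma braid_catVl u : braid_equiv (inv_word u ++ u) [::].
Proof. by rewrite -{2}[u]inv_wordK; apply: braid_catV. Qed.

Lemma braid_inv u v : braid_equiv u v ->
  braid_equiv (inv_word u) (inv_word v).
Proof.
move=> uv; apply: (@braid_trans (inv_word u ++ (v ++ inv_word v))).
  rewrite -{1}[inv_word u]cats0; apply: braid_cat; first exact: braid_refl.
  exact: braid_sym (braid_catV v).
rewrite catA -{2}[inv_word v]cat0s.
apply: braid_cat; last exact: braid_refl.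
apply: braid_trans (braid_catVl u).
by apply: braid_cat; [exact: braid_refl|exact: braid_sym].
Qed.

Variant is_braid_pi : braid -> Prop := IsBraidPi u : is_braid_pi (\pi_(braid) u).

Lemma braid_piV x : is_braid_pi x.
Proof. by rewrite -[x]reprK. Qed.

Definition braid_mul (x y : braid) : braid := \pi_(braid) (repr x ++ repr y).
Definition braid_one : braid := \pi_(braid) [::].
Definition braid_invg (x : braid) : braid := \pi_(braid) (inv_word (repr x)).

Lemma braid_piP u v : braid_equiv u v <-> \pi_(braid) u = \pi_(braid) v.
Proof.
split=> [uv|/eqquotP/asboolP //].
by apply/eqquotP; apply/asboolP.
Qed.

Lemma braid_reprK u : braid_equiv (repr (\pi_(braid) u)) u.
Proof. by apply/braid_piP; rewrite reprK. Qed.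

Lemma braid_mulE u v :
  braid_mul (\pi_(braid) u) (\pi_(braid) v) = \pi_(braid) (u ++ v).
Proof. by apply/braid_piP; apply: braid_cat; apply: braid_reprK. Qed.

Lemma braid_invE u : braid_invg (\pi_(braid) u) = \pi_(braid) (inv_word u).
Proof. by apply/braid_piP/braid_inv/braid_reprK. Qed.

Lemma braid_mulA : associative braid_mul.
Proof.
move=> x y z; case/braid_piV: x => u; case/braid_piV: y => v.
by case/braid_piV: z => w; rewrite !braid_mulE catA.
Qed.

Lemma braid_mul1 : left_id braid_one braid_mul.
Proof. by move=> x; case/braid_piV: x => u; rewrite braid_mulE. Qed.

Lemma braid_mulr1 : right_id braid_one braid_mul.
Proof. by move=> x; case/braid_piV: x => u; rewrite braid_mulE cats0. Qed.

Lemma braid_mulV : left_inverse braid_one braid_invg braid_mul.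
Proof.
by move=> x; case/braid_piV: x => u; rewrite braid_invE braid_mulE; apply/braid_piP/braid_catVl.
Qed.

Lemma braid_mulrV : right_inverse braid_one braid_invg braid_mul.
Proof.
by move=> x; case/braid_piV: x => u; rewrite braid_invE braid_mulE; apply/braid_piP/braid_catV.
Qed.

HB.instance Definition _ := isGroup.Build braid
  braid_mulA braid_mul1 braid_mulr1 braid_mulV braid_mulrV.

Definition sigma (i : 'I_n.-1) : braid := \pi_(braid) [:: (i, true)].

End BraidGroup.

Section BraidRepresentation.
Variable C : numClosedFieldType.

Lemma strand_dim d n (i : 'I_n.-1) :
  (d ^ i * (d * d) * d ^ (n - i.+2) = d ^ n)%N.
Proof.
rewrite mulnn -!expnD addn2 subnKC //.
by case: n i => [|[|n]] [].
Qed.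

(* tensmx orders basis tensors lexicographically, so the cast is the canonical
   identification of the threefold product with the n-th tensor power. *)
Definition on_strands d n (R : 'M[C]_(d * d)) (i : 'I_n.-1) : 'M[C]_(d ^ n) :=
  castmx (strand_dim d i, strand_dim d i)
    ((1%:M : 'M_(d ^ i)) *t R *t (1%:M : 'M_(d ^ (n - i.+2)))).

Definition unitary_representation (G : groupType) N (rho : G -> 'M[C]_N) :=
  [/\ forall g, rho g \is unitarymx,
      rho 1%g = 1%:M &
      forall g h, rho (g * h)%g = rho g *m rho h].

(* The two conditions determine rho, since the sigma i generate the group. *)
Definition braid_representation d n (R : 'M[C]_(d * d))
    (rho : braid n -> 'M[C]_(d ^ n)) :=
  unitary_representation rho /\ forall i, rho (sigma i) = on_strands R i.

End BraidRepresentation.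

Section MetricGroups.
Variables (C : numClosedFieldType) (A : finZmodType).
Implicit Types (q chi F Q P : A -> C) (a b c x : A).

Definition bichar q a b : C := q (a + b) / (q a * q b).

Definition metric_form q :=
  [/\ forall a, `|q a| = 1,
      forall a, q (- a) = q a,
      forall a b c, bichar q (a + b) c = bichar q a c * bichar q b c,
      forall a b c, bichar q a (b + c) = bichar q a b * bichar q a c &
      forall a, (forall b, bichar q a b = 1) -> a = 0].

Definition U1_character chi :=
  (forall a, `|chi a| = 1) /\ (forall a b, chi (a + b) = chi a * chi b).

Definition character_twist q Q :=
  exists2 chi, U1_character chi & forall a, Q a = q a * chi a.

Definition gauss F : C := (sqrtC #|A|%:R)^-1 * \sum_a F a.

Local Notation k := #|A|.

(* Coordinate i of 'cV_k corresponds to the basis vector e_(enum_val i). *)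
Definition shift_op a : 'M[C]_k :=
  \matrix_(i, j) (enum_val i == enum_val j + a)%:R.

Definition clock_op q a : 'M[C]_k :=
  \matrix_(i, j) (bichar q a (enum_val j) *+ (i == j)).

Definition R_I q Q : 'M[C]_(k * k) :=
  (sqrtC k%:R)^-1 *: \sum_a Q a *: (shift_op a *t clock_op q a).

Definition R_II q Q P : 'M[C]_(k * k) :=
  ((gauss P)^* / k%:R) *: \sum_t \sum_c
    (Q t * P c) *: ((shift_op t *m clock_op q c) *t
                    (shift_op (- t) *m clock_op q c)).

Definition P_op q a : 'M[C]_((k * k) * (k * k)) :=
  (1%:M *t clock_op q a) *t (clock_op q a *t 1%:M).

Definition Q_op b : 'M[C]_((k * k) * (k * k)) :=
  (shift_op b *t 1%:M) *t (shift_op b *t shift_op b).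

Definition R_III q : 'M[C]_((k * k) * (k * k)) :=
  k%:R^-1 *: \sum_a \sum_b ((q a)^-1 * (q b)^-1) *: (P_op q a *m Q_op (- b)).

End MetricGroups.

(* Main.v *)
(** All three operators are built from the Gauss operators
    [G = |A|^(-1/2) sum_a Q a *: T a], where [T] is a homomorphism from [A] to
    the Weyl (generalised Pauli) operators and [Q] a quadratic function.
    If [T a *m U = beta a b *: (U *m T a)] for all [a], then completing the
    square gives [G *m U *m G^-1 = (Q b)^-1 *: (U *m T (- b))].  Hence [G]
    normalises the finite group of Weyl operators up to roots of unity, and
    this rule also yields the Yang--Baxter relations.  The Weyl operators of
    [n] strands have only scalars as commutant, so an element of the
    normaliser is known up to a scalar from its action on them.  The scalar is
    pinned down up to finitely many choices by the determinant: the eigenvalues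
    of [G] are [gauss Q / Q c], and [gauss Q] is a root of unity. *)
Require Import Defs.
From mathcomp Require Import all_boot all_order all_algebra.
From mathcomp Require Import boolp classical_sets cardinality reals.
From mathcomp.real_closed Require Import complex mxtens.
From mathcomp Require Import ring zify.

Set Implicit Arguments.
Unset Strict Implicit.
Unset Printing Implicit Defensive.

Import GRing.Theory Num.Theory.
Local Open Scope sesquilinear_scope.
Local Open Scope ring_scope.

(** * Gauss sums of quadratic functions *)

(** Conjugation on the Weyl operators bounds the image only modulo scalars, so every phase has to be
    controlled as well; this is where the order of Gauss sums enters. The exponent [4 * |A| ^ 2] is
    a common multiple for all of them: values of the bicharacter have order dividing [|A|], values
    of [Q] order dividing [2 * |A|], and Gauss sums and determinants are killed by the full
    exponent. A type I generator is a single Gauss operator, and neighbours are linked by the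
    bicharacter. A type II generator is a product of two commuting Gauss operators, each of which
    braids with the other kind on the next pair of strands, so the relation splits into two of type
    I. In type III the two factors do not commute, and they pair by the same bicharacter on equal
    and on neighbouring pairs, so nothing splits. There the discrepancy between neighbouring
    generators commutes with all operators involved, and on its joint eigenspaces both generators
    live in one copy of the Heisenberg group. *)

Section Characters.
Variables (C : numClosedFieldType) (A : finZmodType).
Local Notation k := #|A|.

Lemma card_zmod_gt0 : (0 < k)%N.
Proof. by apply/card_gt0P; exists 0. Qed.

Lemma card_zmod_neq0 : k%:R != 0 :> C.
Proof. by rewrite pnatr_eq0 -lt0n card_zmod_gt0. Qed.

(** Translation by [a] permutes A, so the sum of all elements is unchanged when [a] is added to each
    of them. *)
Lemma mulrn_card (a : A) : a *+ k = 0.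
Proof.
apply: (addIr (\sum_b b)); rewrite add0r [RHS](reindex_inj (addrI a)) /=.
by rewrite big_split /= sumr_const.
Qed.

Section OneCharacter.
Variable phi : A -> C.
Hypotheses (phi0 : phi 0 = 1) (phiD : forall a b, phi (a + b) = phi a * phi b).

Lemma char_mulrn a n : phi (a *+ n) = phi a ^+ n.
Proof. by elim: n => [|n IH]; rewrite ?mulr0n // mulrS exprS phiD IH. Qed.

Lemma char_root a : phi a ^+ k = 1.
Proof. by rewrite -char_mulrn mulrn_card phi0. Qed.

Lemma sum_char a : phi a != 1 -> \sum_b phi b = 0.
Proof.
move=> phia; have : phi a * \sum_b phi b = \sum_b phi b.
  rewrite mulr_sumr [RHS](reindex_inj (addrI a)) /=.
  by apply: eq_bigr => b _; rewrite phiD.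
move/eqP; rewrite -subr_eq0 -{2}[\sum_b _]mul1r -mulrBl mulf_eq0 subr_eq0.
by rewrite (negPf phia) => /eqP.
Qed.

End OneCharacter.
End Characters.

(** The condition is stable under multiplication by characters, so [q] and all its twists share one
    [beta]. Keeping [beta] abstract also covers the inverse form that type III uses. *)
Definition quadratic (C : fieldType) (A : zmodType) (beta : A -> A -> C)
    (Q : A -> C) :=
  (forall a, Q a != 0) /\ (forall a b, Q (a + b) = Q a * Q b * beta a b).

Section NondegenerateBicharacter.
Variables (C : numClosedFieldType) (A : finZmodType) (beta : A -> A -> C).
Local Notation k := #|A|.

Definition nondegenerate_bichar :=
  [/\ forall a b, beta a b = beta b a,
      forall a b, beta a b != 0,
      forall a b c, beta a (b + c) = beta a b * beta a c &
      forall a, (forall b, beta a b = 1) -> a = 0].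

Hypothesis bb : nondegenerate_bichar.

Lemma bicharC a b : beta a b = beta b a. Proof. by case: bb. Qed.
Lemma bichar_neq0 a b : beta a b != 0. Proof. by case: bb. Qed.
Lemma bicharDr a b c : beta a (b + c) = beta a b * beta a c.
Proof. by case: bb. Qed.
Lemma bicharDl a b c : beta (a + b) c = beta a c * beta b c.
Proof. by rewrite bicharC bicharDr ![beta c _]bicharC. Qed.
Lemma bichar0r a : beta a 0 = 1.
Proof.
by apply: (mulfI (bichar_neq0 a 0)); rewrite -bicharDr addr0 mulr1.
Qed.
Lemma bichar0l a : beta 0 a = 1. Proof. by rewrite bicharC bichar0r. Qed.
Lemma bicharNr a b : beta a (- b) = (beta a b)^-1.
Proof.
apply: (mulfI (bichar_neq0 a b)).
by rewrite -bicharDr subrr bichar0r mulfV ?bichar_neq0.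
Qed.
Lemma bicharNl a b : beta (- a) b = (beta a b)^-1.
Proof. by rewrite bicharC bicharNr bicharC. Qed.
Lemma bichar_root a b : beta a b ^+ k = 1.
Proof. by apply: (char_root (bichar0r a)) => c d; apply: bicharDr. Qed.

Lemma sum_bichar b : \sum_a beta a b = k%:R *+ (b == 0).
Proof.
case: (eqVneq b 0) => [->|b0].
  by under eq_bigr do rewrite bichar0r; rewrite sumr_const.
have [c bc] : exists c, beta c b != 1.
  apply: contrapT => /forallNP nc; case/eqP: b0; case: bb => _ _ _; apply=> c.
  by rewrite bicharC; apply/eqP; apply: contrapT => /negP; apply: nc.
by apply: (sum_char _ bc) => x y; apply: bicharDl.
Qed.

(** Orthogonality of characters, counted twice. If [phi] were none of the [beta _ b], summing
    [(phi a)^-1 * beta a b] over [a] first would give 0, whereas summing over [b] first leaves only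
    [a = 0], which contributes [|A|]. *)
Lemma char_bichar (phi : A -> C) : phi 0 = 1 ->
    (forall a b, phi (a + b) = phi a * phi b) ->
  exists b, forall a, phi a = beta a b.
Proof.
move=> phi0 phiD; have phiN0 a : phi a != 0.
  apply/eqP => pa; move: (oner_neq0 C); rewrite -phi0 -(subrr a) phiD pa mul0r.
  by rewrite eqxx.
apply: contrapT => /forallNP nb.
have : \sum_b \sum_a (phi a)^-1 * beta a b = 0.
  apply: big1 => b _; have /existsNP [a /eqP ab] := nb b.
  apply: (@sum_char _ _ (fun a => (phi a)^-1 * beta a b) _ a) => [x y|].
    by rewrite phiD bicharDl invfM mulrACA.
  apply: contra ab => /eqP; rewrite mulrC => /divr1_eq ->.
  exact: eqxx.
rewrite exchange_big /= (bigD1 0) //= [X in _ + X]big1 => [|a a0].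
  rewrite addr0 phi0 invr1; under eq_bigr do rewrite mul1r bichar0l.
  by rewrite sumr_const => /eqP; rewrite (negPf (card_zmod_neq0 C A)).
rewrite -mulr_sumr; under eq_bigr do rewrite bicharC.
by rewrite sum_bichar (negPf a0) mulr0.
Qed.

Section Quadratic.
Variable Q : A -> C.
Hypothesis hQ : quadratic beta Q.

Lemma quadN0 a : Q a != 0. Proof. by case: hQ. Qed.
Lemma quadD a b : Q (a + b) = Q a * Q b * beta a b. Proof. by case: hQ. Qed.
Lemma quad0 : Q 0 = 1.
Proof.
apply: (mulfI (quadN0 0)); rewrite mulr1 -{3}[0]addr0 quadD bichar0r mulr1.
by [].
Qed.

Lemma quadN a : Q a * Q (- a) = beta a a.
Proof.
have := quadD a (- a); rewrite subrr quad0 bicharNr => e.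
by apply: (mulIf (invr_neq0 (bichar_neq0 a a))); rewrite -e mulfV ?bichar_neq0.
Qed.

Lemma quad_shift c a : Q a * beta a c = Q (a + c) / Q c.
Proof. by rewrite quadD mulrAC mulfK ?quadN0. Qed.

Lemma quad_mulrn a n : Q (a *+ n) = Q a ^+ n * beta a a ^+ 'C(n, 2).
Proof.
elim: n => [|n IH]; first by rewrite mulr0n quad0 !expr0 mulr1.
rewrite mulrSr quadD IH binS bin1 exprD exprSr.
have -> : beta (a *+ n) a = beta a a ^+ n.
  apply: (@char_mulrn _ _ (fun x => beta x a)) => [|x y]; first exact: bichar0l.
  exact: bicharDl.
by ring.
Qed.

(** The factor 2 makes the binomial exponent of [beta a a] in [quad_mulrn] a multiple of [k]: it is
    [k * (2 * k - 1)], whereas ['C(k, 2)] need not be such a multiple for even [k]. *)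
Lemma quad_root a : Q a ^+ (2 * k) = 1.
Proof.
have := quad_mulrn a (2 * k); rewrite mulnC mulrnA mulrn_card mul0rn quad0.
have -> : 'C(k * 2, 2) = (k * (k * 2).-1)%N.
  by rewrite bin2 muln2 -!doubleMl doubleK.
by rewrite [beta a a ^+ _]exprM bichar_root expr1n mulr1.
Qed.

Lemma gauss_bichar c : \sum_a Q a * beta a c = (Q c)^-1 * \sum_a Q a.
Proof.
under eq_bigr do rewrite quad_shift.
by rewrite -mulr_suml mulrC [in RHS](reindex_inj (addIr c)).
Qed.

(* With S the Fourier matrix and T = diag Q one has
   S T S = gamma(Q) T^-1 S^-1 T^-1, and S^4 = 1; now take determinants. *)
Lemma gauss_root : gauss Q ^+ (4 * k ^ 2) = 1.
Proof.
pose s : C := (sqrtC k%:R)^-1.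
have s2 : s * s * k%:R = 1.
  by rewrite -invfM -expr2 sqrtCK mulVf ?card_zmod_neq0.
pose S : 'M[C]_k := s *: \matrix_(i, j) beta (enum_val i) (enum_val j).
pose S' : 'M[C]_k := s *: \matrix_(i, j) (beta (enum_val i) (enum_val j))^-1.
pose T : 'M[C]_k := diag_mx (\row_j Q (enum_val j)).
pose T' : 'M[C]_k := diag_mx (\row_j (Q (enum_val j))^-1).
(* The permutation matrix of negation. Since [S'] is both the inverse of the Fourier matrix [S] and
   equal to [S *m J], with [J] an involution, [\det S] has order dividing 4. *)
pose J : 'M[C]_k := \matrix_(i, j) (enum_val i == - enum_val j)%:R.
have SE i j : S i j = s * beta (enum_val i) (enum_val j) by rewrite !mxE.
have S'E i j : S' i j = s * (beta (enum_val i) (enum_val j))^-1 by rewrite !mxE.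
have sumE (F : A -> C) : \sum_(i < k) F (enum_val i) = \sum_a F a.
  by rewrite [RHS](reindex_onto enum_val enum_rank) //= => [|? _];
    [apply: eq_bigl => i; rewrite enum_valK eqxx | rewrite enum_rankK].
have SS' : S *m S' = 1%:M.
  apply/matrixP=> i j; rewrite !mxE.
  under eq_bigr do rewrite SE S'E.
  rewrite (sumE (fun x => s * beta (enum_val i) x
                          * (s * (beta x (enum_val j))^-1))).
  under eq_bigr => x _ do
    rewrite mulrACA -bicharNr [beta _ x]bicharC -bicharDr.
  rewrite -mulr_sumr sum_bichar subr_eq0 (inj_eq enum_val_inj).
  by case: (i == j); rewrite ?mulr0 // s2.
have SJ : S' = S *m J.
  apply/matrixP=> i j; rewrite S'E !mxE.
  under eq_bigr do rewrite SE !mxE.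
  rewrite (sumE (fun x => s * beta (enum_val i) x * (x == - enum_val j)%:R)).
  rewrite (bigD1 (- enum_val j)) //= big1 => [|x /negPf ->];
    last by rewrite mulr0.
  by rewrite eqxx mulr1 addr0 bicharNr.
have JJ : J *m J = 1%:M.
  apply/matrixP=> i j; rewrite !mxE.
  under eq_bigr do rewrite !mxE.
  rewrite (sumE (fun x => (enum_val i == - x)%:R * (x == - enum_val j)%:R)).
  rewrite (bigD1 (- enum_val j)) //= big1 => [|x /negPf ->];
    last by rewrite mulr0.
  by rewrite eqxx mulr1 addr0 opprK (inj_eq enum_val_inj).
have STS : S *m T *m S = gauss Q *: (T' *m S' *m T').
  apply/matrixP=> i j.
  rewrite [S *m T]mul_mx_diag [T' *m S']mul_diag_mx mul_mx_diag !mxE.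
  under eq_bigr do rewrite !mxE.
  rewrite (sumE (fun x => s * beta (enum_val i) x * Q x
                          * (s * beta x (enum_val j)))).
  have E x : s * beta (enum_val i) x * Q x * (s * beta x (enum_val j)) =
      s * s * (Q x * beta x (enum_val i + enum_val j)).
    by rewrite bicharDr [beta _ x]bicharC; ring.
  under eq_bigr do rewrite E.
  rewrite -mulr_sumr gauss_bichar /gauss -/s quadD !invfM.
  by ring.
have dT : \det T ^+ (2 * k) = 1.
  rewrite det_diag -prodrXl; apply: big1 => i _.
  by rewrite mxE quad_root.
have TT' : \det T * \det T' = 1.
  rewrite !det_diag -big_split /=; apply: big1 => i _.
  by rewrite !mxE mulfV ?quadN0.
have dSS : \det S * \det S' = 1 by rewrite -det_mulmx SS' det1.
have dJ : \det J ^+ 2 = 1 by rewrite expr2 -det_mulmx JJ det1.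
have dS : \det S ^+ 4 = 1.
  have e : \det S * (\det S * \det J) = 1 by rewrite -det_mulmx -SJ.
  transitivity ((\det S * (\det S * \det J)) ^+ 2); last by rewrite e expr1n.
  by rewrite !exprMn dJ mulr1 -exprD.
have := congr1 determinant STS; rewrite detZ !det_mulmx => e.
have {}e : gauss Q ^+ k = \det T ^+ 3 * \det S ^+ 3.
  transitivity (gauss Q ^+ k * (\det T * \det T') ^+ 2 * (\det S * \det S')).
    by rewrite TT' dSS expr1n !mulr1.
  transitivity (gauss Q ^+ k * (\det T' * \det S' * \det T') *
    (\det T ^+ 2 * \det S)); first by ring.
  by rewrite -e; ring.
(* One factor [k] is the size of the matrices; the other, [4 * k], is a common multiple of the
   orders [2 * k] of [\det T] and 4 of [\det S]. *)
have -> : (4 * k ^ 2 = k * (2 * (2 * k)))%N by lia.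
rewrite exprM e exprMn -!exprM.
have -> : (3 * (2 * (2 * k)) = (2 * k) * 6)%N by lia.
rewrite exprM dT expr1n mul1r.
have -> : (2 * k * 6 = 4 * (3 * k))%N by lia.
by rewrite exprM dS expr1n.
Qed.

End Quadratic.
End NondegenerateBicharacter.

(** * Gauss operators *)

Section GaussOperators.
Variables (C : numClosedFieldType) (A : finZmodType) (beta : A -> A -> C).
Hypothesis bb : nondegenerate_bichar beta.
Variable N : nat.
Local Notation k := #|A|.
Local Notation s0 := (sqrtC k%:R)^-1.
Implicit Types (Q P : A -> C) (T S : A -> 'M[C]_N) (U : 'M[C]_N).

Definition operator_hom T :=
  T 0 = 1%:M /\ (forall a b, T (a + b) = T a *m T b).

(* Locked because the scaling lemmas would otherwise match its body. *)
Definition gauss_op Q T : 'M[C]_N := locked (s0 *: \sum_a Q a *: T a).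

Lemma gauss_opE Q T : gauss_op Q T = s0 *: \sum_a Q a *: T a.
Proof. by rewrite /gauss_op -lock. Qed.

Lemma operator_homN T a : operator_hom T -> T a *m T (- a) = 1%:M.
Proof. by case=> T0 TD; rewrite -TD subrr. Qed.

Lemma gauss_op_comm Q T U : (forall a, T a *m U = U *m T a) ->
  gauss_op Q T *m U = U *m gauss_op Q T.
Proof.
move=> TU; rewrite !gauss_opE -scalemxAl -scalemxAr mulmx_suml mulmx_sumr.
by congr (_ *: _); apply: eq_bigr => a _; rewrite -scalemxAl -scalemxAr TU.
Qed.

Lemma gauss_op_conj Q T U b : operator_hom T -> quadratic beta Q ->
    (forall a, T a *m U = beta a b *: (U *m T a)) ->
  gauss_op Q T *m U = (Q b)^-1 *: (U *m T (- b) *m gauss_op Q T).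
Proof.
move=> [T0 TD] hQ TU; rewrite !gauss_opE -scalemxAl -scalemxAr scalerA mulrC.
rewrite -scalerA; congr (_ *: _); rewrite mulmx_suml mulmx_sumr scaler_sumr.
rewrite [RHS](reindex_inj (addIr b)) /=; apply: eq_bigr => a _.
rewrite -scalemxAl TU scalerA (quad_shift hQ) -scalemxAr -mulmxA -TD scalerA.
by rewrite [- b + _]addrC addrK mulrC.
Qed.

(** On the left both [T]-operators are expanded and the middle factor is moved to the right end by
    the conjugation rule; on the right the first two factors are expanded. Both sides become double
    sums of products of [T] and [S] values followed by the same [gauss_op P S], and the coefficients
    are compared. *)
Lemma gauss_op_braid Q P T S : operator_hom T -> operator_hom S ->
    quadratic beta Q -> quadratic beta P ->
    (forall a b, T a *m S b = beta a b *: (S b *m T a)) ->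
  gauss_op Q T *m gauss_op P S *m gauss_op Q T =
  gauss_op P S *m gauss_op Q T *m gauss_op P S.
Proof.
move=> hT hS hQ hP TS.
have ST b : gauss_op P S *m T b = (P (- b))^-1 *: (T b *m S b *m gauss_op P S).
  rewrite -{4}[b]opprK; apply: gauss_op_conj => // a.
  rewrite TS scalerA [beta b a](bicharC bb) (bicharNr bb).
  by rewrite mulVf ?(bichar_neq0 bb) ?scale1r.
transitivity (s0 *: (s0 *: \sum_t \sum_u
    (Q t * Q u / P (- u)) *: (T (t + u) *m S u *m gauss_op P S))).
  move: (gauss_op P S) ST => G ST.
  rewrite !gauss_opE -!scalemxAl; congr (_ *: _).
  rewrite -scalemxAr; congr (_ *: _).
  rewrite !mulmx_suml; apply: eq_bigr => t _.
  rewrite mulmx_sumr; apply: eq_bigr => u _.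
  rewrite -!scalemxAl -!scalemxAr -[T t *m G *m _]mulmxA ST hT.2 -scalemxAr.
  by rewrite !scalerA !mulmxA.
transitivity (s0 *: (s0 *: \sum_u \sum_t
    (P u * Q t) *: (S u *m T t *m gauss_op P S))); last first.
  move: {1 3}(gauss_op P S) => G.
  rewrite !gauss_opE -!scalemxAl -scalemxAr -!scalemxAl; congr (_ *: (_ *: _)).
  rewrite !mulmx_suml; apply: eq_bigr => u _.
  rewrite -!scalemxAl mulmx_sumr mulmx_suml scaler_sumr. apply: eq_bigr => t _.
  by rewrite -scalemxAr -!scalemxAl scalerA.
congr (_ *: (_ *: _)); rewrite exchange_big /=; apply: eq_bigr => u _.
(* Substitute [t = d - u]. The coefficients then match because
   [Q u * Q (- u) = beta u u = P u * P (- u)]: both functions have the same polarisation. *)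
rewrite [LHS](reindex_inj (addIr (- u))) /=; apply: eq_bigr => d _.
rewrite subrK TS -scalemxAl scalerA; congr (_ *: _).
rewrite (quadD hQ) (bicharNr bb).
have -> : P u = beta u u / P (- u).
  by rewrite -(quadN bb hP) mulfK ?(quadN0 hP).
rewrite -(quadN bb hQ); field.
by rewrite (bichar_neq0 bb) (quadN0 hP).
Qed.

(** * Eigenvalues, determinant and unitarity of Gauss operators *)

Section SpectralProjectors.
Variable T : A -> 'M[C]_N.
Hypothesis hT : operator_hom T.

(** Projector onto the subspace where every [T b] acts as the scalar [beta b c]; by [char_bichar]
    every character of A arises from some [c]. *)
Definition spectral_proj c : 'M[C]_N :=
  locked (k%:R^-1 *: \sum_a beta a (- c) *: T a).

Lemma spectral_projE c :
  spectral_proj c = k%:R^-1 *: \sum_a beta a (- c) *: T a.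
Proof. by rewrite /spectral_proj -lock. Qed.

Lemma mul_spectral_proj b c :
  T b *m spectral_proj c = beta b c *: spectral_proj c.
Proof.
rewrite !spectral_projE -scalemxAr scalerA mulrC -scalerA; congr (_ *: _).
rewrite mulmx_sumr scaler_sumr [RHS](reindex_inj (addrI b)) /=.
apply: eq_bigr => a _; rewrite -scalemxAr -hT.2 scalerA (bicharDl bb).
by rewrite mulrA (bicharNr bb b) mulfV ?mul1r ?(bichar_neq0 bb).
Qed.

Lemma sum_spectral_proj : \sum_c spectral_proj c = 1%:M.
Proof.
under eq_bigr do rewrite spectral_projE.
rewrite -scaler_sumr exchange_big /= (bigD1 0) //= [X in _ + X]big1 => [|a a0].
  under eq_bigr do rewrite (bichar0l bb) scale1r hT.1.
  by rewrite addr0 sumr_const -scaler_nat scalerA mulVf ?scale1r ?card_zmod_neq0.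
rewrite -scaler_suml (reindex_inj oppr_inj) /=.
under eq_bigr do rewrite opprK (bicharC bb).
by rewrite (sum_bichar bb) (negPf a0) scale0r.
Qed.

Lemma spectral_proj_comm U c : (forall a, T a *m U = U *m T a) ->
  spectral_proj c *m U = U *m spectral_proj c.
Proof.
move=> TU; rewrite !spectral_projE -scalemxAl -scalemxAr mulmx_suml mulmx_sumr.
by congr (_ *: _); apply: eq_bigr => a _; rewrite -scalemxAl -scalemxAr TU.
Qed.

(** The projectors sum to the identity. This allows identities to be checked one eigenspace at a
    time without choosing an eigenbasis. *)
Lemma eq_spectral_proj (X Y : 'M[C]_N) :
  (forall c, X *m spectral_proj c = Y *m spectral_proj c) -> X = Y.
Proof.
move=> XY; rewrite -[X]mulmx1 -[Y]mulmx1 -sum_spectral_proj !mulmx_sumr.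
exact: eq_bigr.
Qed.

Lemma gauss_op_spectral_proj Q c : quadratic beta Q ->
  gauss_op Q T *m spectral_proj c = (gauss Q / Q c) *: spectral_proj c.
Proof.
move=> hQ; rewrite !gauss_opE -scalemxAl mulmx_suml.
under eq_bigr do rewrite -scalemxAl mul_spectral_proj scalerA.
rewrite -scaler_suml (gauss_bichar hQ) scalerA /gauss.
by congr (_ *: _); ring.
Qed.

Lemma gauss_eigenvalue_root Q c : quadratic beta Q ->
  (gauss Q / Q c) ^+ (4 * k ^ 2) = 1.
Proof.
move=> hQ; rewrite expr_div_n (gauss_root bb hQ).
have -> : (4 * k ^ 2 = 2 * k * (2 * k))%N by lia.
by rewrite exprM (quad_root bb hQ) expr1n divr1.
Qed.

(** The power [G ^+ (4 * k ^ 2)] acts as 1 on every eigenspace, hence is the identity;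
    multiplicities of eigenvalues never have to be counted. *)
Lemma det_gauss_op Q : quadratic beta Q ->
  \det (gauss_op Q T) ^+ (4 * k ^ 2) = 1.
Proof.
move=> hQ; set G := gauss_op Q T.
have detX n : \det (G ^+ n) = \det G ^+ n.
  by elim: n => [|n IH]; rewrite ?expr0 ?det1 // !exprS -mulmxE det_mulmx IH.
rewrite -detX -[RHS](det1 C N); congr (\det _).
apply: eq_spectral_proj => c; rewrite mul1mx.
rewrite -[RHS]scale1r -(gauss_eigenvalue_root c hQ).
elim: (4 * k ^ 2)%N => [|n IH]; first by rewrite !expr0 mul1mx scale1r.
rewrite !exprSr -mulmxE -mulmxA gauss_op_spectral_proj // -scalemxAr IH.
by rewrite scalerA mulrC.
Qed.

(** On each eigenspace the adjoint acts by the conjugate eigenvalue, and the eigenvalue has modulus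
    one because it is a root of unity. *)
Lemma gauss_op_unitary Q : quadratic beta Q -> (forall a, `|Q a| = 1) ->
  (forall a, (T a)^t* = T (- a)) -> gauss_op Q T \is unitarymx.
Proof.
move=> hQ nQ Tadj; apply/unitarymxP; apply: eq_spectral_proj => c.
rewrite mul1mx -mulmxA.
have nbeta a b : `|beta a b| = 1.
  have := quadD hQ a b; move=> /(congr1 Num.norm).
  by rewrite !normrM !nQ !mul1r => <-.
have -> : (gauss_op Q T)^t* *m spectral_proj c =
    (gauss Q / Q c)^* *: spectral_proj c.
  have -> : (gauss_op Q T)^t* = s0^* *: \sum_a (Q a)^* *: T (- a).
    rewrite !gauss_opE linearZ /= map_mxZ linear_sum /= map_mx_sum.
    by under eq_bigr do rewrite linearZ /= map_mxZ Tadj.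
  rewrite -scalemxAl mulmx_suml.
  under eq_bigr => a _ do rewrite -scalemxAl mul_spectral_proj scalerA.
  rewrite -scaler_suml scalerA; congr (_ *: _).
  have -> : gauss Q / Q c = s0 * \sum_a Q a * beta a c.
    by rewrite (gauss_bichar hQ) /gauss; ring.
  rewrite rmorphM rmorph_sum; congr (_ * _); apply: eq_bigr => a _.
  rewrite rmorphM (bicharNl bb); congr (_ * _).
  apply: (mulfI (bichar_neq0 bb a c)); rewrite mulfV ?(bichar_neq0 bb) //.
  by rewrite -normCK nbeta expr1n.
rewrite -scalemxAr gauss_op_spectral_proj // scalerA mulrC -normCK.
suff -> : `|gauss Q / Q c| = 1 by rewrite expr1n scale1r.
apply/eqP; rewrite -(@pexpr_eq1 _ _ (4 * k ^ 2)) ?normr_ge0 //.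
  by rewrite -normrX gauss_eigenvalue_root // normr1.
by rewrite muln_gt0 expn_gt0 card_zmod_gt0.
Qed.

End SpectralProjectors.
End GaussOperators.

(** * Braid relations between Gauss operators *)

Section BraidRelations.
Variables (C : numClosedFieldType) (A : finZmodType) (beta : A -> A -> C).
Hypothesis bb : nondegenerate_bichar beta.
Variable N : nat.
Local Notation G := (@gauss_op C A N).
Implicit Types (Q P : A -> C).

(* The a's commute with each other, and so do the b's, hence both sides split
   into the words in (a1, b2) and in (b1, a2). *)
Lemma braid_mul (a1 b1 a2 b2 : 'M[C]_N) :
    a1 *m b1 = b1 *m a1 -> a2 *m b2 = b2 *m a2 ->
    a1 *m a2 = a2 *m a1 -> b1 *m b2 = b2 *m b1 ->
    a1 *m b2 *m a1 = b2 *m a1 *m b2 -> b1 *m a2 *m b1 = a2 *m b1 *m a2 ->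
  (a1 *m b1) *m (a2 *m b2) *m (a1 *m b1) =
  (a2 *m b2) *m (a1 *m b1) *m (a2 *m b2).
Proof.
move=> ab1 ab2 aa bB braid1 braid2.
have swap (c d Z : 'M[C]_N) : c *m d = d *m c -> c *m (d *m Z) = d *m (c *m Z).
  by move=> cd; rewrite !mulmxA cd.
transitivity ((a1 *m b2 *m a1) *m (b1 *m a2 *m b1)).
  rewrite -!mulmxA (swap a2 b2) // (swap b1 b2) // (swap a2 a1) //.
  by rewrite (swap b1 a1).
rewrite braid1 braid2 -!mulmxA (swap a2 b2) // ab2.
by rewrite (swap a2 a1) // (swap b1 b2) // (swap a2 b2).
Qed.

Lemma comm_mul (a1 b1 a2 b2 : 'M[C]_N) :
    a1 *m a2 = a2 *m a1 -> a1 *m b2 = b2 *m a1 ->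
    b1 *m a2 = a2 *m b1 -> b1 *m b2 = b2 *m b1 ->
  (a1 *m b1) *m (a2 *m b2) = (a2 *m b2) *m (a1 *m b1).
Proof.
move=> aa ab ba bB.
rewrite -mulmxA [b1 *m _]mulmxA ba !mulmxA aa -!mulmxA; congr (_ *m _).
by rewrite bB !mulmxA ab.
Qed.

(** * The braid relation for two factors that do not commute *)

Section HalfTwist.
Variable Q : A -> C.
Hypotheses (hQ : quadratic beta Q) (Qeven : forall a, Q (- a) = Q a).
Variables p s : bool -> A -> 'M[C]_N.
Hypotheses (hp : forall i, operator_hom (p i))
           (hs : forall i, operator_hom (s i)).
Hypotheses (pp : forall i j a b, p i a *m p j b = p j b *m p i a)
           (ss : forall i j a b, s i a *m s j b = s j b *m s i a)
           (ps : forall i j a b, p i a *m s j b = beta a b *: (s j b *m p i a)).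

Let x := G Q (p true).
Let y := G Q (s true).
Let x' := G Q (p false).
Let y' := G Q (s false).
(** Normal form of the Weyl words in [s true] and [p true]. Passing [x] or [y] through it acts on
    the exponents by the elementary transvections [(a, b) -> (a, b - a)] and [(a, b) -> (a + b, b)];
    the rules below carry a trailing [Z] so that they apply inside right-nested products. *)
Let w z a b := z *: (s true a *m p true b).

Lemma quad_even a : beta a a = Q a ^+ 2.
Proof. by rewrite -(quadN bb hQ) Qeven expr2. Qed.

Lemma sp_comm i j a b : s i a *m p j b = beta (- a) b *: (p j b *m s i a).
Proof.
rewrite ps scalerA (bicharNl bb) [beta b a](bicharC bb).
by rewrite mulVf ?scale1r ?(bichar_neq0 bb).
Qed.

Lemma xw z a b (Z : 'M[C]_N) :
  x *m (w z a b *m Z) = w (z / Q a) a (b - a) *m (x *m Z).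
Proof.
have xs := gauss_op_conj (hp true) hQ (fun c => ps true true c a).
have xp : x *m p true b = p true b *m x by apply: gauss_op_comm => c; apply: pp.
rewrite /w -!scalemxAl -!scalemxAr -!mulmxA [x *m (s true a *m _)]mulmxA xs.
rewrite -!scalemxAl scalerA -!mulmxA [x *m (_ *m Z)]mulmxA xp.
by rewrite addrC (hp true).2 !mulmxA.
Qed.

(** Exchanging the roles of [p] and [s] inverts [beta], so the conjugation rule is used at [- b] and
    evenness brings back [Q b]. Restoring the order of [s] before [p] costs [beta b b = Q b ^+ 2],
    which turns [(Q b)^-1] into [Q b]. *)
Lemma yw z a b (Z : 'M[C]_N) :
  y *m (w z a b *m Z) = w (z * Q b) (a + b) b *m (y *m Z).
Proof.
have yp : y *m p true b = (Q b)^-1 *: (p true b *m s true b *m y).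
  rewrite -[Q b]Qeven -{4}[b]opprK.
  apply: (gauss_op_conj (hs true) hQ) => c.
  by rewrite sp_comm (bicharNl bb) (bicharNr bb).
have ys : y *m s true a = s true a *m y by apply: gauss_op_comm => c; apply: ss.
rewrite /w -!scalemxAl -!scalemxAr -!mulmxA [y *m (s true a *m _)]mulmxA ys.
rewrite -!mulmxA [y *m (_ *m Z)]mulmxA yp -!scalemxAl -!scalemxAr scalerA.
rewrite -!mulmxA [p true b *m _]mulmxA ps -!scalemxAl -!scalemxAr scalerA.
rewrite quad_even (hs true).2 -!mulmxA; congr (_ *: _).
by field; rewrite (quadN0 hQ).
Qed.

Lemma pw c z a b (Z : 'M[C]_N) :
  p true c *m (w z a b *m Z) = w (z * beta c a) a (c + b) *m Z.
Proof.
rewrite /w -!scalemxAl -!scalemxAr -!mulmxA [p true c *m (s _ a *m _)]mulmxA ps.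
by rewrite (hp true).2 -!scalemxAl scalerA !mulmxA.
Qed.

Lemma sw c z a b (Z : 'M[C]_N) :
  s true c *m (w z a b *m Z) = w z (c + a) b *m Z.
Proof. by rewrite /w (hs true).2 -!scalemxAl -!scalemxAr !mulmxA. Qed.

(* On a joint eigenspace of the central operators [p false a *m p true (- a)]
   and [s false a *m s true (- a)], [x'] and [y'] are scalar multiples of
   [p true b *m x] and [s true b *m y] for some [b].  Both sides then
   reduce to the same [w z a b *m (x *m y) ^+ 3]. *)
Lemma half_twist_braid :
  (x *m y) *m (x' *m y') *m (x *m y) = (x' *m y') *m (x *m y) *m (x' *m y').
Proof.
pose pi a := p false a *m p true (- a).
pose tau a := s false a *m s true (- a).
have hpi : operator_hom pi.
  split=> [|a b]; first by rewrite /pi oppr0 !(hp _).1 mulmx1.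
  rewrite /pi opprD !(hp _).2 -!mulmxA; congr (_ *m _).
  by rewrite !mulmxA; congr (_ *m _); rewrite pp.
have htau : operator_hom tau.
  split=> [|a b]; first by rewrite /tau oppr0 !(hs _).1 mulmx1.
  rewrite /tau opprD !(hs _).2 -!mulmxA; congr (_ *m _).
  by rewrite !mulmxA; congr (_ *m _); rewrite ss.
apply: (eq_spectral_proj bb hpi) => m; apply: (eq_spectral_proj bb htau) => l.
set Em := spectral_proj _ _ _; set El := spectral_proj _ _ _.
rewrite -!(mulmxA _ Em); set E := Em *m El.
have pip c i a : pi c *m p i a = p i a *m pi c.
  by rewrite /pi -mulmxA pp !mulmxA pp.
have tauS c i a : tau c *m s i a = s i a *m tau c.
  by rewrite /tau -mulmxA ss !mulmxA ss.
have pis c i a : pi c *m s i a = s i a *m pi c.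
  rewrite /pi -mulmxA ps -scalemxAr !mulmxA ps -scalemxAl scalerA.
  by rewrite -(bicharDl bb) addNr (bichar0l bb) scale1r.
have taup c i a : tau c *m p i a = p i a *m tau c.
  rewrite /tau -mulmxA sp_comm -scalemxAr !mulmxA sp_comm -scalemxAl scalerA.
  by rewrite -(bicharDl bb) addNr (bichar0l bb) scale1r.
have pE i a : p i a *m E = E *m p i a.
  rewrite /E mulmxA -(spectral_proj_comm _ _ (fun c => pip c i a)) -mulmxA.
  by rewrite -(spectral_proj_comm _ _ (fun c => taup c i a)) mulmxA.
have sE i a : s i a *m E = E *m s i a.
  rewrite /E mulmxA -(spectral_proj_comm _ _ (fun c => pis c i a)) -mulmxA.
  by rewrite -(spectral_proj_comm _ _ (fun c => tauS c i a)) mulmxA.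
have EE : El *m Em = E.
  apply: spectral_proj_comm => a; rewrite /Em.
  apply/esym/spectral_proj_comm => b.
  by rewrite /tau [pi b *m _]mulmxA pis -mulmxA pis mulmxA.
have p'E a : p false a *m E = beta a m *: (E *m p true a).
  rewrite -[p false a]mulmx1 -(operator_homN (- a) (hp true)) opprK mulmxA.
  rewrite -[_ *m p true a *m E]mulmxA pE [_ *m (E *m _)]mulmxA -/(pi a).
  by rewrite {1}/E [pi a *m _]mulmxA mul_spectral_proj // -!scalemxAl.
have s'E a : s false a *m E = beta a l *: (E *m s true a).
  rewrite -[s false a]mulmx1 -(operator_homN (- a) (hs true)) opprK mulmxA.
  rewrite -[_ *m s true a *m E]mulmxA sE [_ *m (E *m _)]mulmxA -/(tau a).
  by rewrite -EE [tau a *m _]mulmxA mul_spectral_proj // -!scalemxAl.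
(* Only the commutation of [E] with all [p] and [s], and the replacement rules [p'E] and [s'E],
   matter from here on. *)
clearbody E.
have xE (Z : 'M[C]_N) : x *m (E *m Z) = E *m (x *m Z).
  by rewrite mulmxA gauss_op_comm ?mulmxA.
have yE (Z : 'M[C]_N) : y *m (E *m Z) = E *m (y *m Z).
  by rewrite mulmxA gauss_op_comm ?mulmxA.
(* On this eigenspace [T'] is [T] twisted by the character [beta _ c]; completing the square absorbs
   the twist into a translation by [c]. *)
have twist (T T' : A -> 'M[C]_N) c (Z : 'M[C]_N) : operator_hom T ->
    (forall a, T' a *m E = beta a c *: (E *m T a)) ->
    G Q T' *m (E *m Z) = (Q c)^-1 *: (E *m (T (- c) *m (G Q T *m Z))).
  move=> [_ TD] T'E; rewrite !gauss_opE -!scalemxAl -!scalemxAr scalerA mulrC.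
  rewrite -scalerA !mulmxA; congr (_ *: _); rewrite !mulmx_sumr !mulmx_suml.
  rewrite scaler_sumr [RHS](reindex_inj (addIr c)) /=; apply: eq_bigr => a _.
  rewrite -!scalemxAl T'E -scalemxAl scalerA (quad_shift hQ) -!scalemxAr.
  rewrite -!scalemxAl scalerA -[E *m T _ *m T _]mulmxA -TD.
  by rewrite [- c + _]addrC addrK mulrC.
have x'E (Z : 'M[C]_N) :
    x' *m (E *m Z) = (Q m)^-1 *: (E *m (p true (- m) *m (x *m Z))).
  exact: twist.
have y'E (Z : 'M[C]_N) :
    y' *m (E *m Z) = (Q l)^-1 *: (E *m (s true (- l) *m (y *m Z))).
  exact: twist.
have w1 (Z : 'M[C]_N) : Z = w 1 0 0 *m Z.
  by rewrite /w (hp _).1 (hs _).1 scale1r !mul1mx.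
rewrite -!mulmxA -[E]mulmx1.
do ![rewrite ?xE ?yE ?x'E ?y'E -?scalemxAr ?scalerA].
(* The trivial word is inserted just right of the last Weyl factor on each side; the rules then move
   all Weyl factors leftwards into it. *)
rewrite [in LHS](w1 (y *m (x *m (y *m 1%:M)))) [in RHS](w1 (y *m 1%:M)).
do ![rewrite ?xw ?yw ?pw ?sw].
have e1 : - l + (- m + l) = - m by rewrite addrCA addNr addr0.
have e2 : - m + l + m = l by rewrite addrAC addNr add0r.
have e3 : - m + (l + m) = l by rewrite addrCA addNr addr0.
rewrite !addr0 !sub0r !opprK !e1 !opprK !e2 !e1 !opprK !e3.
rewrite /w -!scalemxAl -!scalemxAr !scalerA; congr (_ *: _).
rewrite !Qeven (quadD hQ) Qeven !(bicharNl bb) !(bicharNr bb) !invrK quad_even.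
by field; rewrite !(quadN0 hQ) (bichar_neq0 bb).
Qed.

End HalfTwist.
End BraidRelations.

(** * Representations of the braid group from its generators *)

Section BraidExtension.
Variables (C : numClosedFieldType) (n N : nat) (r : 'I_n.-1 -> 'M[C]_N).
Hypotheses (runitary : forall i, r i \is unitarymx)
  (rfar : forall i j : 'I_n.-1, (i.+1 < j)%N -> r i *m r j = r j *m r i)
  (radj : forall i j : 'I_n.-1, i.+1 = j :> nat ->
    r i *m r j *m r i = r j *m r i *m r j).

Definition letter_mx (x : 'I_n.-1 * bool) : 'M[C]_N :=
  if x.2 then r x.1 else (r x.1)^t*.

Definition word_mx (u : braid_word n) : 'M[C]_N :=
  foldr (fun x M => letter_mx x *m M) 1%:M u.

Lemma word_mx_cat u v : word_mx (u ++ v) = word_mx u *m word_mx v.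
Proof. by elim: u => [|x u IH] /=; rewrite ?mul1mx // IH mulmxA. Qed.

Lemma word_mx_equiv u v : braid_equiv u v -> word_mx u = word_mx v.
Proof.
elim=> [a x y b xy|//|a b _ ->//|a b c _ -> _ ->//].
rewrite !word_mx_cat; congr (_ *m (_ *m _)).
case: xy => [i []|i j ij|i j ij] /=; rewrite /letter_mx /= ?mulmx1.
- exact/unitarymxP.
- exact/mulmx1C/unitarymxP.
- exact: rfar.
- by rewrite !mulmxA radj.
Qed.

Lemma word_mx_ind (H : 'M[C]_N -> Prop) : H 1%:M ->
    (forall i, H (r i)) -> (forall i, H ((r i)^t*)) ->
    (forall x y, H x -> H y -> H (x *m y)) ->
  forall u, H (word_mx u).
Proof.
move=> H1 Hr Hradj HM; elim=> [//|[i b] u IH] /=; apply: HM => //.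
by case: b; [apply: Hr|apply: Hradj].
Qed.

(** [rho] evaluates the word chosen to represent a class; by [word_mx_equiv] the choice does not
    affect the value, and closure of [H] keeps every value inside [H]. *)
Lemma braid_extension (H : set 'M[C]_N) : finite_set H -> H 1%:M ->
    (forall i, H (r i)) -> (forall i, H ((r i)^t*)) ->
    (forall x y, H x -> H y -> H (x *m y)) ->
  exists2 rho : braid n -> 'M[C]_N,
    unitary_representation rho /\ (forall i, rho (sigma i) = r i) &
    finite_set (range rho).
Proof.
move=> Hfin H1 Hr Hr' HM.
exists (fun x => word_mx (repr x)); last first.
  by apply: sub_finite_set Hfin => _ [x _ <-]; apply: word_mx_ind.
have piE u : word_mx (repr (\pi_(braid n) u)%qT) = word_mx u.
  exact/word_mx_equiv/braid_reprK.
split; last by move=> i; rewrite piE /= mulmx1.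
split=> [g||g h].
- apply: (@word_mx_ind (fun M => M \is unitarymx)) => // [|i|x y].
  + by apply/unitarymxP; rewrite trmx1 map_mx1 mulmx1.
  + by rewrite trmxC_unitary.
  + exact: mul_unitarymx.
- by rewrite piE.
- by rewrite piE word_mx_cat.
Qed.

End BraidExtension.

(** * Weyl operators and their normaliser *)

Section WeylOperators.
Variables (C : numClosedFieldType) (L : zmodType) (kappa : L -> L -> C).
Variables (N m : nat) (e : 'I_N -> L).
Hypotheses (e_bij : bijective e) (m_gt0 : (0 < m)%N).
Hypotheses (kappa_root : forall a b, kappa a b ^+ m = 1)
  (kappaDl : forall a b c, kappa (a + b) c = kappa a c * kappa b c)
  (kappaDr : forall a b c, kappa a (b + c) = kappa a b * kappa a c)
  (kappa_nondeg : forall a, (forall b, kappa b a = 1) -> a = 0).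

(** This is [X_a Z_b] in the basis indexed by [L]. The group [L] is left general because it is
    instantiated with [A], with [A * A], and with functions from the strands to either. *)
Definition weyl a b : 'M[C]_N :=
  \matrix_(i, j) (kappa b (e j) *+ (e i == e j + a)).

Lemma root_neq0 (z : C) : z ^+ m = 1 -> z != 0.
Proof.
by move=> zm; apply/eqP=> z0; move: zm (oner_neq0 C); rewrite z0 expr0n gtn_eqF
  // => <-; rewrite eqxx.
Qed.

Lemma root_norm (z : C) : z ^+ m = 1 -> `|z| = 1.
Proof.
by move=> zm; apply/eqP; rewrite -(@pexpr_eq1 _ _ m) // -normrX zm normr1.
Qed.

Lemma kappa_neq0 a b : kappa a b != 0. Proof. exact: root_neq0. Qed.

Lemma kappa0r a : kappa a 0 = 1.
Proof.
by apply: (mulfI (kappa_neq0 a 0)); rewrite -kappaDr addr0 mulr1.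
Qed.

Lemma kappa0l a : kappa 0 a = 1.
Proof.
by apply: (mulfI (kappa_neq0 0 a)); rewrite -kappaDl addr0 mulr1.
Qed.

Lemma kappaNr a b : kappa a (- b) = (kappa a b)^-1.
Proof.
apply: (mulfI (kappa_neq0 a b)).
by rewrite -kappaDr subrr kappa0r mulfV ?kappa_neq0.
Qed.

Lemma dim_gt0 : (0 < N)%N.
Proof.
by case: e_bij => g _ _; case: N g => [|//] g; case: (g 0).
Qed.

Lemma weyl_mul a b c d :
  weyl a b *m weyl c d = kappa b c *: weyl (a + c) (b + d).
Proof.
case: e_bij => g eK gK; apply/matrixP=> i j; rewrite !mxE.
rewrite (bigD1 (g (e j + c))) //= big1 => [|l]; last first.
  rewrite !mxE; case: (e l =P e j + c) => [<-|]; first by rewrite eK eqxx.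
  by rewrite !mulr0n mulr0.
rewrite !mxE gK eqxx addr0 mulr1n kappaDr kappaDl [a + c]addrC addrA.
by case: eqP => _; rewrite ?mulr1n ?mulr0n ?mul0r ?mulr0 //; ring.
Qed.

Lemma weyl00 : weyl 0 0 = 1%:M.
Proof.
apply/matrixP=> i j; rewrite !mxE kappa0l addr0 (bij_eq e_bij).
by [].
Qed.

Lemma weyl_unitary a b : weyl a b \is unitarymx.
Proof.
case: e_bij => g eK gK; apply/unitarymxP/matrixP=> i j; rewrite !mxE.
rewrite (bigD1 (g (e i - a))) //= big1 => [|l]; last first.
  rewrite !mxE; case: (e i =P e l + a) => [->|]; first by rewrite addrK eK eqxx.
  by rewrite mulr0n mul0r.
rewrite !mxE gK subrK eqxx addr0 mulr1n (bij_eq e_bij) [j == i]eq_sym.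
case: eqP => _; last by rewrite mulr0n rmorph0 mulr0.
by rewrite mulr1n -normCK root_norm ?expr1n.
Qed.

(** Commuting with the clock operators kills the off-diagonal entries, by nondegeneracy of [kappa];
    commuting with the shifts makes the diagonal constant. *)
Lemma weyl_commutant (M : 'M[C]_N) :
  (forall a b, M *m weyl a b = weyl a b *m M) -> exists z, M = z%:M.
Proof.
move=> Mw; case: (e_bij) => g eK gK.
have offdiag i j : i != j -> M i j = 0.
  apply: contraNeq => Mij; rewrite -(bij_eq e_bij) -subr_eq0; apply/eqP.
  apply: kappa_nondeg => b; have /matrixP /(_ i j) := Mw 0 b; rewrite !mxE.
  rewrite (bigD1 j) //= big1 => [|l lj]; last first.
    by rewrite !mxE addr0 (bij_eq e_bij) (negPf lj) mulr0.
  rewrite [X in _ = X -> _](bigD1 i) //=.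
  rewrite [X in _ = _ + X -> _]big1 => [|l li]; last first.
    by rewrite !mxE addr0 (bij_eq e_bij) eq_sym (negPf li) mul0r.
  rewrite !mxE !addr0 !eqxx !mulr1n mulrC => /(mulIf Mij) bji.
  by rewrite kappaDr kappaNr bji mulfV ?kappa_neq0.
have diag i j : M i i = M j j.
  have /matrixP /(_ i j) := Mw (e i - e j) 0; rewrite !mxE.
  rewrite (bigD1 i) //= big1 => [|l li]; last by rewrite offdiag ?mul0r // eq_sym.
  rewrite [X in _ = X -> _](bigD1 j) //= [X in _ = _ + X -> _]big1 => [|l lj];
    last by rewrite offdiag ?mulr0.
  by rewrite !mxE !addr0 kappa0l [e j + _]addrC subrK eqxx mulr1n mulr1 mul1r.
exists (M (g 0) (g 0)); apply/matrixP=> i j; rewrite !mxE.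
by case: (eqVneq i j) => [->|/offdiag //]; rewrite mulr1n.
Qed.

(** The finite Heisenberg group; phases of order dividing [m] are closed under the cocycle since
    [kappa] takes its values among them. *)
Definition weyl_group : set 'M[C]_N :=
  [set M | exists z a b, z ^+ m = 1 /\ M = z *: weyl a b].

Lemma weyl_groupM x y : weyl_group x -> weyl_group y -> weyl_group (x *m y).
Proof.
move=> [z [a [b [zm ->]]]] [w [c [d [wm ->]]]].
exists (w * (z * kappa b c)), (a + c), (b + d).
rewrite !exprMn zm wm kappa_root !mulr1 -scalemxAl -scalemxAr weyl_mul.
by rewrite !scalerA mulrCA mulrA.
Qed.

Lemma weyl_groupZ z x : z ^+ m = 1 -> weyl_group x -> weyl_group (z *: x).
Proof.
move=> zm [w [c [d [wm ->]]]]; exists (z * w), c, d.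
by rewrite exprMn zm wm mulr1 scalerA.
Qed.

Lemma weyl_in a b : weyl_group (weyl a b).
Proof. by exists 1, a, b; rewrite expr1n scale1r. Qed.

Lemma weyl_group_unitary x : weyl_group x -> x \is unitarymx.
Proof.
move=> [z [a [b [zm ->]]]]; apply/unitarymxP.
rewrite linearZ /= map_mxZ -scalemxAl -scalemxAr scalerA -normCK root_norm //.
by rewrite expr1n scale1r; apply/unitarymxP/weyl_unitary.
Qed.

Lemma weyl_comm a b c d :
  weyl a b *m weyl c d = (kappa b c / kappa d a) *: (weyl c d *m weyl a b).
Proof.
rewrite !weyl_mul scalerA [c + a]addrC [d + b]addrC.
by congr (_ *: _); field; apply: kappa_neq0.
Qed.

Lemma weyl_group_comm x y : weyl_group x -> weyl_group y ->
  exists z, x *m y = z *: (y *m x).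
Proof.
move=> [z [a [b [zm ->]]]] [w [c [d [wm ->]]]].
exists (kappa b c / kappa d a).
rewrite -!scalemxAl -!scalemxAr weyl_comm !scalerA.
by congr (_ *: _); ring.
Qed.

Lemma finite_roots p : (0 < p)%N -> finite_set [set z : C | z ^+ p = 1].
Proof.
move=> p0; have [rs rsE] := closed_field_poly_normal ('X^p - 1 : {poly C}).
apply: (@sub_finite_set _ _ [set` rs]); last exact: finite_seq.
move=> z /= zp; have : root ('X^p - 1 : {poly C}) z.
  by rewrite /root !hornerE zp subrr.
rewrite rsE (monicP (monicXnsubC _ _)) // scale1r.
by rewrite root_prod_XsubC.
Qed.

Lemma finite_weyl_group : finite_set weyl_group.
Proof.
case: (e_bij) => g eK gK.
have := finite_image2 (fun z (ij : 'I_N * 'I_N) => z *: weyl (e ij.1) (e ij.2))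
  (finite_roots m_gt0) (@finite_finset _ [set: 'I_N * 'I_N]%classic).
apply: sub_finite_set => _ [z [a [b [zm ->]]]].
by exists z => //; exists (g a, g b) => //=; rewrite !gK.
Qed.

(** Normalisation is expressed by intertwining equations in both directions, so no inverse occurs
    and passing to the adjoint swaps the two. The determinant condition cuts the scalars down to
    finitely many. *)
Definition clifford : set 'M[C]_N :=
  [set g | [/\ g \is unitarymx,
    forall x, weyl_group x -> exists2 y, weyl_group y & g *m x = y *m g,
    forall x, weyl_group x -> exists2 y, weyl_group y & x *m g = g *m y &
    \det g ^+ m = 1]].

Lemma clifford1 : clifford 1%:M.
Proof.
split=> [|x wx|x wx|]; rewrite ?det1 ?expr1n //.
- by apply/unitarymxP; rewrite trmx1 map_mx1 mulmx1.
- by exists x; rewrite // mul1mx mulmx1.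
- by exists x; rewrite // mul1mx mulmx1.
Qed.

Lemma cliffordM g h : clifford g -> clifford h -> clifford (g *m h).
Proof.
move=> [ug g1 g2 dg] [uh h1 h2 dh]; split.
- exact: mul_unitarymx.
- move=> x /h1 [y /g1 [z wz gy] hx]; exists z => //.
  by rewrite -mulmxA hx mulmxA gy mulmxA.
- move=> x /g2 [y /h2 [z wz gy] hx]; exists z => //.
  by rewrite mulmxA hx -mulmxA gy mulmxA.
- by rewrite det_mulmx exprMn dg dh mulr1.
Qed.

Lemma cliffordZ z g : z ^+ m = 1 -> clifford g -> clifford (z *: g).
Proof.
move=> zm [ug g1 g2 dg]; split.
- apply/unitarymxP; rewrite linearZ /= map_mxZ -scalemxAl -scalemxAr scalerA.
  by rewrite -normCK root_norm // expr1n scale1r; apply/unitarymxP.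
- move=> x /g1 [y wy gy]; exists y => //.
  by rewrite -scalemxAl gy scalemxAr.
- move=> x /g2 [y wy gy]; exists y => //.
  by rewrite -scalemxAl -gy scalemxAr.
- by rewrite detZ exprMn dg exprAC zm expr1n mulr1.
Qed.

Lemma clifford_adj g : clifford g -> clifford (g^t*).
Proof.
move=> [ug g1 g2 dg].
have gg := unitarymxP ug; have gg' := mulmx1C gg.
have ddet : \det (g^t*) = (\det g)^*.
  by rewrite det_map_mx det_tr.
split.
- by rewrite trmxC_unitary.
- move=> x /g2 [y wy gy]; exists y => //.
  by rewrite -[LHS]mulmx1 -gg !mulmxA -[_ *m x *m g]mulmxA gy mulmxA gg' mul1mx.
- move=> x /g1 [y wy gy]; exists y => //.
  by rewrite -[LHS]mul1mx -gg' -!mulmxA [g *m _]mulmxA gy -mulmxA gg mulmx1.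
- by rewrite ddet -rmorphXn dg rmorph1.
Qed.

(** The set is covered by finitely many fibres, one for each table [h] telling which element of the
    Weyl group each basis operator is conjugated to. Two members of one fibre differ by a scalar,
    because [g0^t* *m g] lies in the commutant. *)
Lemma finite_clifford : finite_set clifford.
Proof.
have /finite_seqP [s ws] := finite_weyl_group.
pose I : finType := ('I_N * 'I_N)%type; pose u (x : I) := weyl (e x.1) (e x.2).
pose fiber (h : {ffun I -> 'I_(size s)}) :=
  [set g | clifford g /\ forall x, g *m u x = nth 0 s (h x) *m g]%classic.
apply: (@sub_finite_set _ _ (\bigcup_(h in setT) fiber h)%classic).
  move=> g [ug g1 g2 dg].
  have /choice [h hE] : forall x : I, exists i : 'I_(size s),
      g *m u x = nth 0 s i *m g.
    move=> x; have [y] := g1 _ (weyl_in (e x.1) (e x.2)).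
    rewrite ws /= => ys gy; have yi : (index y s < size s)%N by rewrite index_mem.
    by exists (Ordinal yi); rewrite /= nth_index.
  exists (finfun h) => //; split => // x; rewrite ffunE; exact: hE.
apply: bigcup_finite => [|h _]; first exact: finite_finset.
have [[g0 [[ug0 _ _ dg0] g0E]]|nog] := pselect (exists g, fiber h g); last first.
  apply: (@sub_finite_set _ _ set0) => [g gh|]; last exact: finite_set0.
  by case: nog; exists g.
have gg := unitarymxP ug0; have gg' := mulmx1C gg.
(* The exponent for the scalar [z] in [g = z *: g0]: the determinant contributes [z ^+ N], whose
   [m]-th power must be 1. *)
have Nm : (0 < N * m)%N by rewrite muln_gt0 dim_gt0.
apply: sub_finite_set (finite_image (fun z => z *: g0) (finite_roots Nm)).
move=> g [[ug _ _ dg] gE].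
have [|z zE] := @weyl_commutant (g0^t* *m g).
  case: e_bij => f eK fK a b.
  have := gE (f a, f b); have := g0E (f a, f b); rewrite /u /= !fK => E0 E.
  rewrite -mulmxA E !mulmxA; congr (_ *m _).
  rewrite -[LHS]mulmx1 -gg mulmxA -[_ *m _ *m g0]mulmxA -E0 !mulmxA gg'.
  by rewrite mul1mx.
have gz : g = z *: g0.
  by rewrite -[g]mul1mx -gg -mulmxA zE mul_mx_scalar.
exists z => //=. move: dg; rewrite gz detZ exprMn dg0 mulr1 exprM.
by [].
Qed.

(** * Gauss operators in the normaliser *)

Section GaussClifford.
Variables (A : finZmodType) (beta : A -> A -> C) (Q : A -> C).
Hypotheses (bb : nondegenerate_bichar beta) (hQ : quadratic beta Q).
Hypothesis mE : m = (4 * #|A| ^ 2)%N.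
Variable T : A -> 'M[C]_N.
Hypotheses (hT : operator_hom T) (wT : forall a, weyl_group (T a)).

Lemma quad_root_m a : Q a ^+ m = 1.
Proof.
rewrite mE; have -> : (4 * #|A| ^ 2 = 2 * #|A| * (2 * #|A|))%N by lia.
by rewrite exprM (quad_root bb hQ) expr1n.
Qed.

(** Each Weyl operator commutes with [T a] up to a phase depending multiplicatively on [a]. Such a
    phase is [beta a b] for some [b] by [char_bichar], so the conjugation rule applies and its
    result stays in the Weyl group. *)
Lemma gauss_op_clifford : clifford (gauss_op Q T).
Proof.
have conjT x : weyl_group x -> exists b, forall a,
    T a *m x = beta a b *: (x *m T a).
  move=> wx; have /choice [phi phiE] : forall a, exists z,
      T a *m x = z *: (x *m T a) by move=> a; apply: weyl_group_comm.
  (* Nonvanishing makes the phase unique, so its multiplicativity can be read off from that of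
     [T]. *)
  have xT0 a : x *m T a != 0.
    have /unitarymx_unit : x *m T a \is unitarymx.
      by apply: mul_unitarymx; apply: weyl_group_unitary.
    apply: contraTneq => ->; rewrite unitmxE -(prednK dim_gt0) det0.
    by rewrite unitr0.
  have inj a z w : z *: (x *m T a) = w *: (x *m T a) -> z = w.
    move=> /eqP; rewrite -subr_eq0 -scalerBl scaler_eq0 (negPf (xT0 a)) orbF.
    by rewrite subr_eq0 => /eqP.
  have [|a b|b bE] := char_bichar bb (phi := phi).
  - by apply: (inj 0); rewrite -phiE scale1r hT.1 mul1mx mulmx1.
  - apply: (inj (a + b)); rewrite -phiE hT.2 -mulmxA phiE -scalemxAr.
    by rewrite [T a *m (_ *m _)]mulmxA phiE -scalemxAl scalerA mulrC mulmxA.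
  - by exists b => a; rewrite phiE bE.
have Qinv a : (Q a)^-1 ^+ m = 1 by rewrite exprVn quad_root_m invr1.
split.
- apply: (gauss_op_unitary bb) => // [a|a].
    exact: root_norm (quad_root_m a).
  have /unitarymxP Ta := weyl_group_unitary (wT a).
  rewrite -[LHS]mul1mx -(operator_homN (- a) hT) opprK -mulmxA Ta mulmx1.
  by [].
- move=> x wx; have [b bE] := conjT x wx.
  exists ((Q b)^-1 *: (x *m T (- b))).
    by apply: weyl_groupZ => //; apply: weyl_groupM.
  by rewrite (gauss_op_conj hT hQ bE) scalemxAl.
- move=> x wx; have [b bE] := conjT x wx.
  (* With [G] the Gauss operator, [G x T_b] is [(Q b)^-1] times [x T_(-b) G T_b]; since [T_b]
     commutes with [G], this is [(Q b)^-1] times [x G], which dictates the witness. *)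
  exists (Q b *: (x *m T b)).
    by apply: weyl_groupZ; [apply: quad_root_m | apply: weyl_groupM].
  rewrite -scalemxAr mulmxA (gauss_op_conj hT hQ bE) -scalemxAl scalerA.
  rewrite mulfV ?(quadN0 hQ) // scale1r -!mulmxA; congr (_ *m _).
  rewrite gauss_op_comm => [|a]; last by rewrite -!hT.2 addrC.
  by rewrite mulmxA -hT.2 addNr hT.1 mul1mx.
- by rewrite mE; apply: (det_gauss_op bb).
Qed.

End GaussClifford.
End WeylOperators.

(** * Digits of tensor indices *)

Section Strands.
Variable n : nat.

Definition strandl (i : 'I_n.-1) : 'I_n := widen_ord (leq_pred n) i.
Lemma strandr_subproof (i : 'I_n.-1) : (i.+1 < n)%N.
Proof. by case: i => i /=; lia. Qed.
Definition strandr (i : 'I_n.-1) : 'I_n := Ordinal (strandr_subproof i).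

Lemma strandlr i : (strandl i == strandr i) = false.
Proof. by apply/eqP => /(congr1 val) /=; lia. Qed.

End Strands.

Section Digits.
Variable d : nat.
Hypothesis d_gt0 : (0 < d)%N.

(** A residue modulo [d ^ m] carries the [m] lowest base-[d] digits. For a generator these are the
    strands to the right of its pair, and [eq_div_digits] treats those to the left. *)
Lemma eq_mod_digits m x y : (x %% d ^ m = y %% d ^ m <->
  forall j, j < m -> x %/ d ^ j %% d = y %/ d ^ j %% d)%N.
Proof.
have step u k : (u %% d ^ k.+1 = u %/ d ^ k %% d * d ^ k + u %% d ^ k)%N.
  rewrite {1}(divn_eq (u %% d ^ k.+1) (d ^ k)) expnS modn_divl.
  by rewrite modn_dvdm ?dvdn_mull.
elim: m => [|m IH]; first by rewrite !expn0 !modn1.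
rewrite !step; split=> [e|e].
  have pos : (0 < d ^ m)%N by rewrite expn_gt0 d_gt0.
  have emod : (x %% d ^ m = y %% d ^ m)%N.
    by have := congr1 (modn^~ (d ^ m)%N) e; rewrite !modnMDl !modn_mod.
  move=> j; rewrite ltnS leq_eqVlt => /orP [/eqP ->|]; last exact: IH.1.
  have := congr1 (divn^~ (d ^ m)%N) e; rewrite !divnMDl //.
  by rewrite (divn_small (ltn_pmod x pos)) (divn_small (ltn_pmod y pos)) !addn0.
by rewrite e // IH.2 // => j jm; apply: e; apply: ltnW.
Qed.

Lemma eq_div_digits n m x y : (m <= n -> x < d ^ n -> y < d ^ n ->
  x %/ d ^ m = y %/ d ^ m <->
  forall j, m <= j < n -> x %/ d ^ j %% d = y %/ d ^ j %% d)%N.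
Proof.
move=> mn xn yn; have pos : (0 < d ^ m)%N by rewrite expn_gt0 d_gt0.
have small u : (u < d ^ n -> (u %/ d ^ m) %% d ^ (n - m) = u %/ d ^ m)%N.
  by move=> un; rewrite modn_small // ltn_divLR // -expnD subnK.
have digits u j : (u %/ d ^ m %/ d ^ j = u %/ d ^ (m + j))%N.
  by rewrite -divnMA expnD.
rewrite -(small x) // -(small y) // eq_mod_digits.
split=> e j => [/andP [mj jn]|jn].
  have := e (j - m)%N; rewrite !digits subnKC //; apply; lia.
by rewrite !digits; apply: e; lia.
Qed.

Variable n : nat.

Lemma digit_subproof (l : 'I_n) (x : 'I_(d ^ n)) :
  (x %/ d ^ (n - l.+1) %% d < d)%N.
Proof. by rewrite ltn_mod. Qed.

(* Position 0 carries the most significant digit, as in tensmx. *)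
Definition digit l x : 'I_d := Ordinal (digit_subproof l x).

Definition digits (x : 'I_(d ^ n)) : {ffun 'I_n -> 'I_d} := [ffun l => digit l x].

Lemma digits_bij : bijective digits.
Proof.
apply: inj_card_bij; last by rewrite card_ffun !card_ord.
move=> x y /ffunP xy; apply: val_inj => /=.
rewrite -(modn_small (ltn_ord x)) -(modn_small (ltn_ord y)).
apply/eq_mod_digits => j jn; have ln : (n - j.+1 < n)%N by lia.
have := xy (Ordinal ln); rewrite !ffunE => /(congr1 val) /=.
by have -> : (n - (n - j.+1).+1 = j)%N by lia.
Qed.

(** The two identity factors compare the quotient and the residue of the index, that is, the digits
    on either side of the pair; together they say that all strands outside the pair agree. *)
Lemma on_strands_tens (C : numClosedFieldType) (M M' : 'M[C]_d) i x y :
  on_strands (M *t M') i x y =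
  M (digit (strandl i) x) (digit (strandl i) y) *
  M' (digit (strandr i) x) (digit (strandr i) y) *+
  [forall l, (l == strandl i) || (l == strandr i) || (digit l x == digit l y)].
Proof.
have li := ltn_ord i; set m := (n - i.+2)%N.
have mi : (n - i.+1 = m.+1)%N by rewrite /m; lia.
pose c (u : 'I_(d ^ n)) := cast_ord (esym (strand_dim d i)) u.
have mm : (d ^ m.+2 = d ^ m * (d * d))%N by rewrite !expnSr mulnA.
have EL u : (mxtens_unindex (mxtens_unindex (mxtens_unindex (c u)).1).2).1
    = digit (strandl i) u.
  by apply: val_inj; rewrite /= mi -modn_divl expnSr divnMA.
have ER u : (mxtens_unindex (mxtens_unindex (mxtens_unindex (c u)).1).2).2
    = digit (strandr i) u.
  by apply: val_inj; rewrite /= modn_dvdm ?dvdn_mull.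
rewrite /on_strands castmxE -!/(c _) !mxE !EL !ER.
rewrite -mulr_natr [LHS]mulrAC [RHS]mulrC -natrM mulnb.
congr (_%:R * _); congr nat_of_bool.
rewrite -!val_eqE /= -!divnMA -mm.
have mn : (m.+2 <= n)%N by rewrite /m; lia.
apply/andP/forallP => [[/eqP hi /eqP lo] l|e].
  rewrite -!val_eqE /=; have ln := ltn_ord l.
  have [li'|li'|->] := ltngtP l i; rewrite ?eqxx //=.
    apply/orP; right; apply/eqP.
    apply: ((eq_div_digits mn (ltn_ord x) (ltn_ord y)).1 hi).
    by rewrite /m; lia.
  have [->|li''] := eqVneq (l : nat) i.+1 => //=.
  by apply/eqP; apply: ((eq_mod_digits _ _ _).1 lo); rewrite /m; lia.
have E j : (j < n)%N -> j != m -> j != m.+1 ->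
    (x %/ d ^ j %% d = y %/ d ^ j %% d)%N.
  move=> jn jm jm1; have ln : (n - j.+1 < n)%N by lia.
  have := e (Ordinal ln); rewrite -!val_eqE /=.
  have -> : (n - (n - j.+1).+1 = j)%N by lia.
  by case/orP => [/orP [] /eqP|/eqP //]; rewrite /m in jm jm1; lia.
split; apply/eqP.
  apply/(eq_div_digits mn (ltn_ord x) (ltn_ord y)) => j jn.
  by apply: E; lia.
by apply/eq_mod_digits => j jm; apply: E; lia.
Qed.

End Digits.

(** * Weyl operators on strands *)

Section StrandWeyl.
Variables (C : numClosedFieldType) (K : zmodType) (kappa : K -> K -> C).
Variables (d m n : nat) (e : 'I_d -> K).
Hypotheses (e_bij : bijective e) (m_gt0 : (0 < m)%N).
Hypotheses (kappa_root : forall a b, kappa a b ^+ m = 1)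
  (kappaDl : forall a b c, kappa (a + b) c = kappa a c * kappa b c)
  (kappaDr : forall a b c, kappa a (b + c) = kappa a b * kappa a c)
  (kappa_nondeg : forall a, (forall b, kappa b a = 1) -> a = 0).
Implicit Types (i j : 'I_n.-1) (f g : {ffun 'I_n -> K}).

Let d_gt0 : (0 < d)%N := dim_gt0 e_bij.
Let k0l := kappa0l m_gt0 kappa_root kappaDl.
Let k0r := kappa0r m_gt0 kappa_root kappaDr.

Definition strand_kappa f g := \prod_l kappa (f l) (g l).

Definition strand_basis (x : 'I_(d ^ n)) : {ffun 'I_n -> K} :=
  [ffun l => e (digit d_gt0 l x)].

Lemma strand_basis_bij : bijective strand_basis.
Proof.
have [h eK hK] := e_bij; have [D DK KD] := digits_bij d_gt0 n.
exists (fun f => D [ffun l => h (f l)]) => [x|f].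
  rewrite -[RHS]DK; congr D; apply/ffunP => l; rewrite !ffunE.
  by rewrite eK.
apply/ffunP => l; rewrite ffunE.
have /ffunP /(_ l) := KD [ffun l => h (f l)].
by rewrite !ffunE => ->.
Qed.

Lemma strand_kappa_root f g : strand_kappa f g ^+ m = 1.
Proof. by rewrite -prodrXl big1. Qed.

Lemma strand_kappaDl f g h :
  strand_kappa (f + g) h = strand_kappa f h * strand_kappa g h.
Proof. by rewrite -big_split; apply: eq_bigr => l _; rewrite ffunE. Qed.

Lemma strand_kappaDr f g h :
  strand_kappa f (g + h) = strand_kappa f g * strand_kappa f h.
Proof. by rewrite -big_split; apply: eq_bigr => l _; rewrite ffunE. Qed.

Lemma strand_kappa_nondeg f : (forall g, strand_kappa g f = 1) -> f = 0.
Proof.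
move=> f1; apply/ffunP => l; rewrite [RHS]ffunE; apply: kappa_nondeg => b.
have := f1 [ffun l' => if l' == l then b else 0].
rewrite /strand_kappa (bigD1 l) //= big1 => [|l' /negPf l'l].
  by rewrite ffunE eqxx mulr1.
by rewrite ffunE l'l k0l.
Qed.

Definition pair_at i (v v' : K) : {ffun 'I_n -> K} :=
  [ffun l => if l == strandl i then v else if l == strandr i then v' else 0].

Lemma pair_at_l i v v' : pair_at i v v' (strandl i) = v.
Proof. by rewrite ffunE eqxx. Qed.

Lemma pair_at_r i v v' : pair_at i v v' (strandr i) = v'.
Proof. by rewrite ffunE eqxx eq_sym strandlr. Qed.

Lemma pair_atD i v v' w w' :
  pair_at i v v' + pair_at i w w' = pair_at i (v + w) (v' + w').
Proof.
by apply/ffunP => l; rewrite !ffunE; do 2?[case: ifP => // _]; rewrite addr0.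
Qed.

Lemma pair_at0 i : pair_at i 0 0 = 0.
Proof. by apply/ffunP => l; rewrite !ffunE; do 2?[case: ifP => // _]. Qed.

Lemma strand_kappa_pair i v v' f :
  strand_kappa (pair_at i v v') f =
  kappa v (f (strandl i)) * kappa v' (f (strandr i)).
Proof.
rewrite /strand_kappa (bigD1 (strandl i)) //= pair_at_l; congr (_ * _).
rewrite (bigD1 (strandr i)) ?pair_at_r ?[_ == strandl i]eq_sym ?strandlr //=.
rewrite big1 ?mulr1 // => l /andP [/negPf l1 /negPf l2].
by rewrite ffunE l1 l2 k0l.
Qed.

Lemma strand_kappa_same i v v' w w' :
  strand_kappa (pair_at i v v') (pair_at i w w') = kappa v w * kappa v' w'.
Proof. by rewrite strand_kappa_pair pair_at_l pair_at_r. Qed.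

(** Only the shared strand contributes, the right one of [i] being the left one of [j]. The two
    equations form a product so that one rewrite can use either. *)
Lemma strand_kappa_next i j v v' w w' : i.+1 = j :> nat ->
  (strand_kappa (pair_at i v v') (pair_at j w w') = kappa v' w) *
  (strand_kappa (pair_at j w w') (pair_at i v v') = kappa w v').
Proof.
move=> ij; have rl : strandr i = strandl j by apply: val_inj.
have il : (strandl i == strandl j) = false by rewrite -val_eqE /=; lia.
have ir : (strandl i == strandr j) = false by rewrite -val_eqE /=; lia.
have jr : (strandr j == strandr i) = false by rewrite -val_eqE /=; lia.
rewrite !strand_kappa_pair rl -{2}rl pair_at_l pair_at_r.
by rewrite !ffunE il ir [strandr j == _]eq_sym ir jr !k0r mul1r mulr1.
Qed.

Lemma strand_kappa_far i j v v' w w' : (i.+1 < j)%N ->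
  (strand_kappa (pair_at i v v') (pair_at j w w') = 1) *
  (strand_kappa (pair_at j w w') (pair_at i v v') = 1).
Proof.
move=> ij.
have il : (strandl i == strandl j) = false by rewrite -val_eqE /=; lia.
have ir : (strandl i == strandr j) = false by rewrite -val_eqE /=; lia.
have jl : (strandr i == strandl j) = false by rewrite -val_eqE /=; lia.
have jr : (strandr i == strandr j) = false by rewrite -val_eqE /=; lia.
rewrite !strand_kappa_pair !ffunE ![strandl j == _]eq_sym ![strandr j == _]eq_sym.
by rewrite il ir jl jr !k0r mulr1.
Qed.

Local Notation W := (weyl kappa e).
Local Notation Wn := (weyl strand_kappa strand_basis).

Definition strand_weyl i a b a' b' : 'M[C]_(d ^ n) :=
  on_strands (W a b *t W a' b') i.

(** Weyl operators on two strands are Weyl operators of the group of functions from strands to [K],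
    supported on the pair. All commutation rules between generators thereby reduce to values of
    [strand_kappa]. *)
Lemma strand_weylE i a b a' b' :
  strand_weyl i a b a' b' = Wn (pair_at i a a') (pair_at i b b').
Proof.
apply/matrixP => x y; rewrite /strand_weyl (on_strands_tens d_gt0) !mxE.
rewrite strand_kappa_pair !ffunE.
have -> : (strand_basis x == strand_basis y + pair_at i a a') =
  [&& e (digit d_gt0 (strandl i) x) == e (digit d_gt0 (strandl i) y) + a,
      e (digit d_gt0 (strandr i) x) == e (digit d_gt0 (strandr i) y) + a' &
      [forall l, (l == strandl i) || (l == strandr i) ||
                 (digit d_gt0 l x == digit d_gt0 l y)]].
  apply/eqP/and3P => [/ffunP xy|[/eqP xl /eqP xr /forallP xy]].
    have := xy (strandl i); have := xy (strandr i).
    rewrite ![(_ + _ : {ffun _}) _]ffunE pair_at_l pair_at_r !ffunE.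
    move=> -> ->; split => //; apply/forallP => l.
    have := xy l; rewrite !ffunE.
    case: eqP => //= _; case: eqP => //= _; rewrite addr0.
    by move/(bij_inj e_bij) => ->.
  apply/ffunP => l; rewrite !ffunE.
  case: eqP => [->//|/eqP ll]; case: eqP => [->//|/eqP lr].
  by have := xy l; rewrite (negPf ll) (negPf lr) /= addr0 => /eqP ->.
by case: eqP => _; case: eqP => _; case: [forall l, _];
  rewrite ?mulr1n ?mulr0n ?mul0r ?mulr0.
Qed.

Lemma strand_weyl_comm i j a b a' b' v w v' w' :
  strand_weyl i a b a' b' *m strand_weyl j v w v' w' =
  (strand_kappa (pair_at i b b') (pair_at j v v') /
   strand_kappa (pair_at j w w') (pair_at i a a')) *:
  (strand_weyl j v w v' w' *m strand_weyl i a b a' b').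
Proof.
rewrite !strand_weylE; apply: (weyl_comm strand_basis_bij m_gt0).
- exact: strand_kappa_root.
- exact: strand_kappaDl.
- exact: strand_kappaDr.
Qed.

Lemma strand_weyl_comm_same i a b a' b' v w v' w' :
  strand_weyl i a b a' b' *m strand_weyl i v w v' w' =
  (kappa b v * kappa b' v' / (kappa w a * kappa w' a')) *:
  (strand_weyl i v w v' w' *m strand_weyl i a b a' b').
Proof. by rewrite strand_weyl_comm !strand_kappa_same. Qed.

Lemma strand_weyl_comm_next i j a b a' b' v w v' w' : i.+1 = j :> nat ->
  strand_weyl i a b a' b' *m strand_weyl j v w v' w' =
  (kappa b' v / kappa w a') *:
  (strand_weyl j v w v' w' *m strand_weyl i a b a' b').
Proof.
by move=> ij; rewrite strand_weyl_comm !(strand_kappa_next _ _ _ _ ij).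
Qed.

Lemma strand_weyl_comm_prev i j a b a' b' v w v' w' : i.+1 = j :> nat ->
  strand_weyl j a b a' b' *m strand_weyl i v w v' w' =
  (kappa b v' / kappa w' a) *:
  (strand_weyl i v w v' w' *m strand_weyl j a b a' b').
Proof.
by move=> ij; rewrite strand_weyl_comm !(strand_kappa_next _ _ _ _ ij).
Qed.

Lemma strand_weyl_comm_far i j a b a' b' v w v' w' : (i.+1 < j)%N ->
  strand_weyl i a b a' b' *m strand_weyl j v w v' w' =
  strand_weyl j v w v' w' *m strand_weyl i a b a' b'.
Proof.
move=> ij; rewrite strand_weyl_comm !(strand_kappa_far _ _ _ _ ij).
by rewrite divr1 scale1r.
Qed.

Lemma strand_weyl_mul i a b a' b' v w v' w' :
  strand_weyl i a b a' b' *m strand_weyl i v w v' w' =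
  (kappa b v * kappa b' v') *: strand_weyl i (a + v) (b + w) (a' + v') (b' + w').
Proof.
rewrite !strand_weylE (weyl_mul strand_basis_bij strand_kappaDl strand_kappaDr).
by rewrite strand_kappa_same !pair_atD.
Qed.

Lemma strand_weyl0 i : strand_weyl i 0 0 0 0 = 1%:M.
Proof.
rewrite strand_weylE !pair_at0 (weyl00 strand_basis_bij m_gt0) //.
exact: strand_kappa_root.
exact: strand_kappaDl.
Qed.

Lemma strand_weyl_group i a b a' b' :
  weyl_group strand_kappa m strand_basis (strand_weyl i a b a' b').
Proof. rewrite strand_weylE; exact: weyl_in. Qed.

Lemma strand_representation (R : 'M[C]_(d * d)) :
    (forall i, clifford strand_kappa m strand_basis (on_strands R i)) ->
    (forall i j, (i.+1 < j)%N ->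
      on_strands R i *m on_strands R j = on_strands R j *m on_strands R i) ->
    (forall i j, i.+1 = j :> nat ->
      on_strands R i *m on_strands R j *m on_strands R i =
      on_strands R j *m on_strands R i *m on_strands R j) ->
  exists2 rho : braid n -> 'M[C]_(d ^ n),
    braid_representation R rho & finite_set (range rho).
Proof.
move=> Rcliff Rfar Radj.
apply: (braid_extension _ _ _ (H := clifford strand_kappa m strand_basis)) => //.
- by move=> i; have [] := Rcliff i.
- apply: (finite_clifford strand_basis_bij m_gt0).
  + exact: strand_kappa_root.
  + exact: strand_kappaDl.
  + exact: strand_kappaDr.
  + exact: strand_kappa_nondeg.
- exact: clifford1.
- by move=> i; apply: clifford_adj.
- by move=> x y; apply: cliffordM.
Qed.

Lemma strand_gauss_clifford (A : finZmodType) (beta : A -> A -> C) (Q : A -> C)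
    (T : A -> 'M[C]_(d ^ n)) :
    nondegenerate_bichar beta -> quadratic beta Q -> m = (4 * #|A| ^ 2)%N ->
    operator_hom T ->
    (forall a, exists i x y x' y', T a = strand_weyl i x y x' y') ->
  clifford strand_kappa m strand_basis (gauss_op Q T).
Proof.
move=> bb hQ mE hT TE.
apply: (gauss_op_clifford strand_basis_bij m_gt0 _ _ _ bb hQ) => //.
- exact: strand_kappa_root.
- exact: strand_kappaDl.
- exact: strand_kappaDr.
- by move=> a; have [i [x [y [x' [y' ->]]]]] := TE a; apply: strand_weyl_group.
Qed.

End StrandWeyl.

(** * The three families *)

Section OnStrands.
Variables (C : numClosedFieldType) (d n : nat) (i : 'I_n.-1).
Implicit Types M : 'M[C]_(d * d).

Lemma on_strandsD M M' :
  on_strands (M + M') i = on_strands M i + on_strands M' i.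
Proof.
by apply/matrixP => x y; rewrite mxE /on_strands !castmxE !mxE mulrDr mulrDl.
Qed.

Lemma on_strandsZ c M : on_strands (c *: M) i = c *: on_strands M i.
Proof.
by apply/matrixP => x y; rewrite mxE /on_strands !castmxE !mxE mulrCA !mulrA.
Qed.

Lemma on_strandsM M M' :
  on_strands (M *m M') i = on_strands M i *m on_strands M' i.
Proof.
rewrite /on_strands; case: _ / (strand_dim d i).
by rewrite !castmx_id !tensmx_mul !mulmx1.
Qed.

Lemma on_strands_sum (I : finType) (F : I -> 'M[C]_(d * d)) :
  on_strands (\sum_a F a) i = \sum_a on_strands (F a) i.
Proof.
apply: (big_morph (fun M => on_strands M i)) => [x y|]; first exact: on_strandsD.
by rewrite -[0 in LHS](scale0r (0 : 'M[C]_(d * d))) on_strandsZ scale0r.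
Qed.

Lemma on_strands_gauss_op (A : finZmodType) (Q : A -> C)
    (T : A -> 'M[C]_(d * d)) :
  on_strands (gauss_op Q T) i = gauss_op Q (fun a => on_strands (T a) i).
Proof.
rewrite !gauss_opE on_strandsZ on_strands_sum; congr (_ *: _).
by apply: eq_bigr => a _; rewrite on_strandsZ.
Qed.

End OnStrands.

Lemma gauss_op_comm2 (C : numClosedFieldType) (A B : finZmodType) N
    (Q : A -> C) (P : B -> C) (T : A -> 'M[C]_N) (S : B -> 'M[C]_N) :
  (forall a b, T a *m S b = S b *m T a) ->
  gauss_op Q T *m gauss_op P S = gauss_op P S *m gauss_op Q T.
Proof.
move=> TS; apply: gauss_op_comm => a; apply/esym/gauss_op_comm => b.
exact/esym/TS.
Qed.

Section Types.
Variables (C : numClosedFieldType) (A : finZmodType) (q : A -> C).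
Hypothesis hq : metric_form q.
Variable n : nat.
Local Notation k := #|A|.
Local Notation m := (4 * k ^ 2)%N.

Lemma m_gt0 : (0 < m)%N.
Proof. by rewrite muln_gt0 expn_gt0 card_zmod_gt0. Qed.

Lemma q_neq0 a : q a != 0.
Proof. by rewrite -normr_eq0; case: hq => -> _ _ _ _; rewrite oner_neq0. Qed.

Lemma metric_bichar : nondegenerate_bichar (bichar q).
Proof.
case: hq => _ _ _ qDr qnd; split=> // a b.
  by rewrite /bichar addrC [q b * _]mulrC.
by rewrite mulf_neq0 ?invr_neq0 ?mulf_neq0 ?q_neq0.
Qed.

Lemma metric_quadratic : quadratic (bichar q) q.
Proof.
split=> [|a b]; first exact: q_neq0.
by rewrite /bichar mulrC divfK // mulf_neq0 ?q_neq0.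
Qed.

Lemma twist_quadratic Q : character_twist q Q -> quadratic (bichar q) Q.
Proof.
move=> [chi [nchi chiD] QE]; split=> [a|a b]; rewrite !QE.
  by rewrite mulf_neq0 ?q_neq0 // -normr_eq0 nchi oner_neq0.
by rewrite (quadD metric_quadratic) chiD; ring.
Qed.

Let bb := metric_bichar.

Lemma bichar_root_m a b : bichar q a b ^+ m = 1.
Proof.
have -> : (m = k * (4 * k))%N by lia.
by rewrite exprM (bichar_root bb) expr1n.
Qed.

Lemma bichar_nondegr a : (forall b, bichar q b a = 1) -> a = 0.
Proof.
by move=> a1; case: bb => bC _ _; apply=> b; rewrite bC.
Qed.

Let bDl := bicharDl bb.
Let bDr := bicharDr bb.

(** * Types I and II: Weyl operators of A *)

Section OnA.
Local Notation W := (weyl (bichar q) (@enum_val A predT)).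

Lemma shift_opE a : shift_op C a = W a 0.
Proof. by apply/matrixP=> i j; rewrite !mxE (bichar0l bb). Qed.

Lemma clock_opE a : clock_op q a = W 0 a.
Proof.
by apply/matrixP=> i j; rewrite !mxE addr0 (inj_eq enum_val_inj).
Qed.

Local Notation bij := (enum_val_bij A).
Local Notation root := bichar_root_m.
Local Notation SW := (strand_weyl (n := n) (bichar q) (@enum_val A predT)).

(** The underlying homomorphism is [X_a] tensor [Z_a]. Neighbouring copies meet on the shared strand
    as [Z_a] against [X_b], which produces exactly [bichar q a b], as [gauss_op_braid] demands. *)
Lemma type_I_representation Q : quadratic (bichar q) Q ->
  exists2 rho : braid n -> 'M[C]_(k ^ n),
    braid_representation (R_I q Q) rho & finite_set (range rho).
Proof.
move=> hQ; pose T (i : 'I_n.-1) a := SW i a 0 0 a.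
have TE i : on_strands (R_I q Q) i = gauss_op Q (T i).
  rewrite /R_I -gauss_opE on_strands_gauss_op; congr gauss_op.
  by apply: funext => a; rewrite shift_opE clock_opE.
have hT i : operator_hom (T i).
  split=> [|a b]; first exact: (strand_weyl0 bij m_gt0 root).
  rewrite /T (strand_weyl_mul bij m_gt0 root) // (bichar0l bb) (bichar0r bb).
  by rewrite !addr0 mulr1 scale1r.
apply: (strand_representation (e_bij := bij) m_gt0 root) => //.
- exact: bichar_nondegr.
- move=> i; rewrite TE.
  apply: (strand_gauss_clifford bij m_gt0 root _ _ bb hQ) => //.
  by move=> a; exists i, a, 0, 0, a.
- move=> i j ij; rewrite !TE; apply: gauss_op_comm2 => a b.
  exact: (strand_weyl_comm_far bij m_gt0 root).
- move=> i j ij; rewrite !TE; apply: (gauss_op_braid bb) => // a b.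
  rewrite /T (strand_weyl_comm_next bij m_gt0 root bDl bDr _ _ _ _ _ _ _ _ ij).
  by rewrite (bichar0r bb) divr1.
Qed.

(** The double sum factors into a Gauss operator of shifts [X_t], [X_(-t)] and one of clocks [Z_c],
    [Z_c]. They commute on one pair because the opposite shifts cancel the phases, while shifts of
    one pair braid with clocks of the next and conversely. The prefactor is admissible because the
    Gauss sum is a root of unity. *)
Lemma type_II_representation Q P :
    quadratic (bichar q) Q -> quadratic (bichar q) P ->
  exists2 rho : braid n -> 'M[C]_(k ^ n),
    braid_representation (R_II q Q P) rho & finite_set (range rho).
Proof.
move=> hQ hP.
pose T (i : 'I_n.-1) a := SW i a 0 (- a) 0.
pose S (i : 'I_n.-1) a := SW i 0 a 0 a.
have RE i : on_strands (R_II q Q P) i =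
    (gauss P)^* *: (gauss_op Q (T i) *m gauss_op P (S i)).
  transitivity (on_strands ((gauss P)^* *:
      (gauss_op Q (fun a => W a 0 *t W (- a) 0) *m
       gauss_op P (fun c => W 0 c *t W 0 c))) i).
    congr (on_strands _ i); rewrite /R_II -scalerA; congr (_ *: _).
    rewrite !gauss_opE -scalemxAl -scalemxAr scalerA -invfM -expr2 sqrtCK.
    congr (_ *: _); rewrite mulmx_suml; apply: eq_bigr => t _.
    rewrite mulmx_sumr; apply: eq_bigr => c _.
    rewrite -scalemxAl -scalemxAr scalerA tensmx_mul; congr (_ *: _).
    by rewrite !shift_opE !clock_opE.
  by rewrite on_strandsZ on_strandsM !on_strands_gauss_op.
have hT i : operator_hom (T i).
  split=> [|a b]; first by rewrite /T oppr0; apply: (strand_weyl0 bij m_gt0 root).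
  rewrite /T (strand_weyl_mul bij m_gt0 root) // !(bichar0l bb).
  by rewrite !addr0 mulr1 scale1r opprD.
have hS i : operator_hom (S i).
  split=> [|a b]; first exact: (strand_weyl0 bij m_gt0 root).
  rewrite /S (strand_weyl_mul bij m_gt0 root) // !(bichar0r bb).
  by rewrite !addr0 mulr1 scale1r.
have TS i : gauss_op Q (T i) *m gauss_op P (S i) =
    gauss_op P (S i) *m gauss_op Q (T i).
  apply: gauss_op_comm2 => a b.
  rewrite /T /S (strand_weyl_comm_same bij m_gt0 root) // !(bichar0r bb).
  by rewrite (bicharNr bb) mulfV ?(bichar_neq0 bb) // mul1r divr1 scale1r.
apply: (strand_representation (e_bij := bij) m_gt0 root) => //.
- exact: bichar_nondegr.
- move=> i; rewrite RE; apply: cliffordZ.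
  + exact: m_gt0.
  + by rewrite -rmorphXn (gauss_root bb hP) rmorph1.
  apply: cliffordM.
    apply: (strand_gauss_clifford bij m_gt0 root _ _ bb hQ) => //.
    by move=> a; exists i, a, 0, (- a), 0.
  apply: (strand_gauss_clifford bij m_gt0 root _ _ bb hP) => //.
  by move=> a; exists i, 0, a, 0, a.
- move=> i j ij; rewrite !RE -!scalemxAl -!scalemxAr; congr (_ *: (_ *: _)).
  have far := strand_weyl_comm_far bij m_gt0 root bDl bDr _ _ _ _ _ _ _ _ ij.
  by apply: comm_mul; apply: gauss_op_comm2 => a b; apply: far.
- move=> i j ij; rewrite !RE -!scalemxAl -!scalemxAr -!scalemxAl.
  congr (_ *: (_ *: (_ *: _))).
  apply: braid_mul => //.
  + apply: gauss_op_comm2 => a b.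
    rewrite /T (strand_weyl_comm_next bij m_gt0 root bDl bDr _ _ _ _ _ _ _ _ ij).
    by rewrite !(bichar0l bb) divr1 scale1r.
  + apply: gauss_op_comm2 => a b.
    rewrite /S (strand_weyl_comm_next bij m_gt0 root bDl bDr _ _ _ _ _ _ _ _ ij).
    by rewrite !(bichar0r bb) divr1 scale1r.
  + apply: (gauss_op_braid bb) => // a b.
    rewrite /T /S.
    rewrite (strand_weyl_comm_next bij m_gt0 root bDl bDr _ _ _ _ _ _ _ _ ij).
    by rewrite (bichar0l bb) (bicharNr bb) invrK mul1r (bicharC bb).
  + apply: (gauss_op_braid bb) => // a b.
    rewrite /T /S.
    rewrite (strand_weyl_comm_next bij m_gt0 root bDl bDr _ _ _ _ _ _ _ _ ij).
    by rewrite (bichar0l bb) divr1.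
Qed.

End OnA.

(** * Type III: Weyl operators of A x A *)

Section OnPairs.
Local Notation W := (weyl (bichar q) (@enum_val A predT)).

Definition pair_kappa (u v : A * A) := bichar q u.1 v.1 * bichar q u.2 v.2.

Definition pair_basis (x : 'I_(k * k)) : A * A :=
  (enum_val (mxtens_unindex x).1, enum_val (mxtens_unindex x).2).

Lemma pair_basis_bij : bijective pair_basis.
Proof.
exists (fun u => mxtens_index (enum_rank u.1, enum_rank u.2)) => [x|[a b]].
  case: (mxtens_indexP x) => i j.
  by rewrite /pair_basis mxtens_indexK /= !enum_valK.
by rewrite /pair_basis mxtens_indexK /= !enum_rankK.
Qed.

Lemma pair_kappa_root u v : pair_kappa u v ^+ m = 1.
Proof. by rewrite exprMn !bichar_root_m mulr1. Qed.

Lemma pair_kappaDl u v w :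
  pair_kappa (u + v) w = pair_kappa u w * pair_kappa v w.
Proof. by rewrite /pair_kappa !bDl mulrACA. Qed.

Lemma pair_kappaDr u v w :
  pair_kappa u (v + w) = pair_kappa u v * pair_kappa u w.
Proof. by rewrite /pair_kappa !bDr mulrACA. Qed.

Lemma pair_kappa_nondeg u : (forall v, pair_kappa v u = 1) -> u = 0.
Proof.
case: u => a b ab1; congr (_, _); apply: bichar_nondegr => c.
  by have := ab1 (c, 0); rewrite /pair_kappa /= (bichar0l bb) mulr1.
by have := ab1 (0, c); rewrite /pair_kappa /= (bichar0l bb) mul1r.
Qed.

Local Notation W2 := (weyl pair_kappa pair_basis).

Lemma tens_weyl a b a' b' : W a b *t W a' b' = W2 (a, a') (b, b').
Proof.
apply/matrixP => x y; rewrite !mxE [pair_basis x == _]xpair_eqE.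
by case: eqP => _; case: eqP => _; rewrite ?mulr0n ?mul0r ?mulr0.
Qed.

Local Notation bij := pair_basis_bij.
Local Notation root := pair_kappa_root.
Local Notation SW := (strand_weyl (n := n) pair_kappa pair_basis).
Let kDl := pair_kappaDl.
Let kDr := pair_kappaDr.

(** The coefficients [q^-1] of type III are quadratic for the inverse form, which is also the phase
    between [P_a] and [Q_(-b)]. *)
Let beta a b := (bichar q a b)^-1.
Let Q a := (q a)^-1.

Lemma inv_bichar : nondegenerate_bichar beta.
Proof.
split=> [a b|a b|a b c|a ab]; rewrite /beta.
- by rewrite (bicharC bb).
- by rewrite invr_neq0 ?(bichar_neq0 bb).
- by rewrite bDr invfM.
- by case: bb => _ _ _; apply=> b; rewrite -[LHS]invrK -/(beta a b) ab invr1.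
Qed.

Lemma inv_quadratic : quadratic beta Q.
Proof.
split=> [a|a b]; rewrite /Q; first by rewrite invr_neq0 ?q_neq0.
by rewrite /beta -!invfM -(quadD metric_quadratic).
Qed.

(** The clocks of [P_a] and the shifts of [Q_(-b)] share exactly one tensor slot, on the same pair
    of strands as well as on neighbouring pairs in either order. Hence one phase [beta a b] occurs
    in all four cases, which is the situation of [half_twist_braid]; evenness comes from the metric
    form. *)
Lemma type_III_representation :
  exists2 rho : braid n -> 'M[C]_((k * k) ^ n),
    braid_representation (R_III q) rho & finite_set (range rho).
Proof.
pose p (i : 'I_n.-1) a := SW i 0 (0, a) 0 (a, 0).
pose s (i : 'I_n.-1) b := SW i (- b, 0) 0 (- b, - b) 0.
have RE i : on_strands (R_III q) i = gauss_op Q (p i) *m gauss_op Q (s i).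
  transitivity (on_strands
      (gauss_op Q (fun a => W2 0 (0, a) *t W2 0 (a, 0)) *m
       gauss_op Q (fun b => W2 (- b, 0) 0 *t W2 (- b, - b) 0)) i); last first.
    by rewrite on_strandsM !on_strands_gauss_op.
  congr (on_strands _ i); rewrite /R_III.
  rewrite !gauss_opE -scalemxAl -scalemxAr scalerA -invfM -expr2 sqrtCK.
  congr (_ *: _); rewrite mulmx_suml; apply: eq_bigr => a _.
  rewrite mulmx_sumr; apply: eq_bigr => b _.
  rewrite -scalemxAl -scalemxAr scalerA /P_op /Q_op !shift_opE clock_opE.
  by rewrite -(weyl00 (enum_val_bij A) m_gt0 bichar_root_m bDl) !tens_weyl.
have pairE (a b c d : A) : (a, b) + (c, d) = (a + c, b + d) by [].
have hp i : operator_hom (p i).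
  split=> [|a b]; first exact: (strand_weyl0 bij m_gt0 root).
  rewrite /p (strand_weyl_mul bij m_gt0 root) // /pair_kappa /=.
  by rewrite !(bichar0r bb) !mulr1 scale1r !pairE !addr0.
have hs i : operator_hom (s i).
  split=> [|a b].
    by rewrite /s oppr0; apply: (strand_weyl0 bij m_gt0 root).
  rewrite /s (strand_weyl_mul bij m_gt0 root) // /pair_kappa /=.
  by rewrite !(bichar0l bb) !mulr1 scale1r !pairE !addr0 !opprD.
apply: (strand_representation (e_bij := bij) m_gt0 root) => //.
- exact: pair_kappa_nondeg.
- move=> i; rewrite RE; apply: cliffordM.
    apply: (strand_gauss_clifford bij m_gt0 root kDl kDr inv_bichar
      inv_quadratic) => //.
    by move=> a; exists i, 0, (0, a), 0, (a, 0).
  apply: (strand_gauss_clifford bij m_gt0 root kDl kDr inv_bichar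
      inv_quadratic) => //.
  by move=> a; exists i, (- a, 0), 0, (- a, - a), 0.
- move=> i j ij; rewrite !RE.
  have far := strand_weyl_comm_far bij m_gt0 root kDl kDr _ _ _ _ _ _ _ _ ij.
  by apply: comm_mul; apply: gauss_op_comm2 => a b; apply: far.
- move=> i j ij; rewrite !RE.
  pose same := strand_weyl_comm_same bij m_gt0 root kDl kDr.
  pose next := strand_weyl_comm_next bij m_gt0 root kDl kDr _ _ _ _ _ _ _ _ ij.
  pose prev := strand_weyl_comm_prev bij m_gt0 root kDl kDr _ _ _ _ _ _ _ _ ij.
  pose side b := if b then i else j.
  have Qeven a : Q (- a) = Q a by rewrite /Q; case: hq => _ -> _ _ _.
  apply: (half_twist_braid inv_bichar inv_quadratic Qeven
    (p := fun b => p (side b)) (s := fun b => s (side b))) => //.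
  (* The four cases are each pair of strands against itself and the two neighbours in either order;
     the tuple picks the commutation rule that fits. *)
  + move=> [] [] a b; rewrite /p /= (same, next, prev) /pair_kappa /=;
      by rewrite !(bichar0r bb) !mulr1 divr1 scale1r.
  + move=> [] [] a b; rewrite /s /= (same, next, prev) /pair_kappa /=;
      by rewrite !(bichar0l bb) !mulr1 divr1 scale1r.
  + move=> [] [] a b; rewrite /p /s /= (same, next, prev) /pair_kappa /=;
      by rewrite ?(bichar0l bb) ?(bichar0r bb) ?mulr1 ?mul1r divr1 (bicharNr bb).
Qed.

End OnPairs.
End Types.

Theorem theorem8p4 (R : realType) (A : finZmodType) (q : A -> R[i])
    (hq : metric_form q) (n : nat) (hn : (2 <= n)%N) (Q P : A -> R[i])
    (hQ : character_twist q Q) (hP : character_twist q P) :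
  [/\ exists2 rho : braid n -> 'M[R[i]]_(#|A| ^ n),
        braid_representation (R_I q Q) rho & finite_set (range rho),
      exists2 rho : braid n -> 'M[R[i]]_(#|A| ^ n),
        braid_representation (R_II q Q P) rho & finite_set (range rho) &
      exists2 rho : braid n -> 'M[R[i]]_((#|A| * #|A|) ^ n),
        braid_representation (R_III q) rho & finite_set (range rho)].
Proof.
have qQ := twist_quadratic hq hQ; have qP := twist_quadratic hq hP.
split.
- exact: (type_I_representation hq n qQ).
- exact: (type_II_representation hq n qQ qP).
- exact: (type_III_representation hq n).
Qed.
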